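(* Let $S_b=G_b^TA_b^{-1}G_b$ be the Schur complement obtained by eliminating the bubble functions of the MINI element (see context), and let $L$ be the stiffness matrix corresponding to the Laplace operator discretized with piecewise linear continuous finite elements. Then the following spectral equivalence result holds: $$S_b\eqsim h^2L,$$ where the constants hidden in ''$\eqsim$'' are independent of the mesh size. That is, there are constants $c_0,c_1>0$, independent of the mesh size, such that $c_0\,h^2\,x^TLx\le x^TS_bx\le c_1\,h^2\,x^TLx$ for all $x\in\mathbb{R}^{n_V}$.
   Context: Let $\mathcal{T}_h$ be a triangulation (into simplices) of a domain $\Omega\subset\mathbb{R}^d$, with mesh size $h$ and $n_V$ vertices. Let $Q_h$ be the space of continuous scalar functions that are piecewise linear with respect to $\mathcal{T}_h$, with nodal basis $\{\phi_i\}_{i=1}^{n_V}$, and let $L_{ij}=\int_\Omega\nabla\phi_j\cdot\nabla\phi_i$. For $T\in\mathcal{T}_h$ let $\lambda_{1,T},\dots,\lambda_{d+1,T}$ be the barycentric coordinates on $T$ and let $\varphi_{b,T}=\alpha_T\lambda_{1,T}\cdots\lambda_{d+1,T}$ on $T$ (extended by $0$ outside $T$), where the normalizing constant $\alpha_T$ is chosen so that $\varphi_{b,T}=1$ at the barycenter of $T$. The space of bubble functions of the MINI element is $V_b=\operatorname{span}\{\varphi_{b,T}e_1,\dots,\varphi_{b,T}e_d\}_{T\in\mathcal{T}_h}$, where $e_1,\dots,e_d$ is the canonical basis of $\mathbb{R}^d$. Let $\lambda,\mu$ be the Lamé coefficients of a linearly elastic, homogeneous, isotropic medium, $\varepsilon(u)=\frac12(\nabla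 u+\nabla u^T)$ the strain tensor, and $$a(u,v)=2\mu\int_\Omega\varepsilon(u):\varepsilon(v)+\lambda\int_\Omega\operatorname{div}u\,\operatorname{div}v.$$ $A_b$ is the matrix of $a(\cdot,\cdot)$ on $V_b$ in the basis $\{\varphi_{b,T}e_j:\ T\in\mathcal{T}_h,\ j=1,\dots,d\}$, and $G_b$ is the matrix of the bilinear form $-(\operatorname{div}v_b,p)=(v_b,\nabla p)$ (with $(\cdot,\cdot)$ the $L^2(\Omega)$ inner product), $v_b\in V_b$, $p\in Q_h$, with rows indexed by the basis of $V_b$ and columns by the nodal basis of $Q_h$.
   Formalization: The triangulations are assumed shape regular and quasi-uniform with fixed bounds, on which the constants may depend (for arbitrary meshes the lower bound fails), and the domain is assumed equal to the interior of its closure. *)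

(* Defs.v *)
From HB Require Import structures.
From mathcomp Require Import all_boot all_order all_algebra.
From mathcomp Require Import all_classical all_reals all_analysis.
Set Implicit Arguments.
Unset Strict Implicit.
Unset Printing Implicit Defensive.
Import Order.TTheory GRing.Theory Num.Theory.
Import numFieldNormedType.Exports.

Local Open Scope classical_set_scope.
Local Open Scope ring_scope.

(* Lebesgue measure on the Borel sets of R^n, by iterated products; R^n is
   represented by [n.-tuple R], which carries the product sigma-algebra. *)
Section lebesgue_Rn.
Context {R : realType}.
Local Notation mR := (measurableTypeR R).

Definition cons_pair n (p : mR * n.-tuple mR) : n.+1.-tuple mR :=
  [the n.+1.-tuple mR of p.1 :: p.2].

Definition uncons_pair n (t : n.+1.-tuple mR) : mR * n.-tuple mR :=
  (thead t, [tuple of behead t]).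

Lemma cons_pairK n : cancel (@cons_pair n) (@uncons_pair n).
Proof. by case=> x t; rewrite /uncons_pair theadE; congr pair; exact/val_inj. Qed.

Lemma measurable_cons_pair n : measurable_fun setT (@cons_pair n).
Proof. exact: measurable_cons. Qed.

Lemma measurable_uncons_pair n : measurable_fun setT (@uncons_pair n).
Proof.
by apply: measurable_fun_pair; [exact: measurable_tnth|exact: measurable_behead].
Qed.

Section step.
Variables (n : nat) (m : {sigma_finite_measure set (n.-tuple mR) -> \bar R}).

Definition lebesgue_cons : set (n.+1.-tuple mR) -> \bar R :=
  pushforward (@lebesgue_measure R \x m)%E (@cons_pair n).

Let preimage_cons_measurable A :
  measurable A -> measurable (@cons_pair n @^-1` A).
Proof.
by move=> mA; rewrite -[X in measurable X]setTI; exact: measurable_cons_pair.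
Qed.

Let lebesgue_cons0 : lebesgue_cons set0 = 0%E.
Proof. by rewrite /lebesgue_cons /pushforward preimage_set0 measure0. Qed.

Let lebesgue_cons_ge0 A : (0 <= lebesgue_cons A)%E.
Proof. exact: integral_ge0. Qed.

Let lebesgue_cons_sigma_additive : semi_sigma_additive lebesgue_cons.
Proof.
move=> F mF tF mUF; rewrite /lebesgue_cons /pushforward preimage_bigcup.
apply: measure_semi_sigma_additive.
- by move=> k; exact: preimage_cons_measurable.
- apply/trivIsetP => /= i j _ _ ij; rewrite -preimage_setI.
  by move/trivIsetP : tF => /(_ _ _ _ _ ij) ->//; rewrite preimage_set0.
- by rewrite -preimage_bigcup; exact: preimage_cons_measurable.
Qed.

HB.instance Definition _ := isMeasure.Build _ _ _ lebesgue_cons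
  lebesgue_cons0 lebesgue_cons_ge0 lebesgue_cons_sigma_additive.

Let lebesgue_cons_sigma_finite : sigma_finite setT lebesgue_cons.
Proof.
have /sigma_finiteP[F [TF ndF Foo]] := sigma_finiteT (@lebesgue_measure R).
have /sigma_finiteP[G [TG ndG Goo]] := sigma_finiteT m.
exists (fun k => @uncons_pair n @^-1` (F k `*` G k)).
  rewrite -preimage_bigcup -(preimage_setT (@uncons_pair n)); congr (_ @^-1` _).
  rewrite -setXTT TF TG predeqE => -[x y]; split.
    move=> [/= [i _ Fx] [j _ Gy]]; exists (maxn i j) => //; split.
    - by move: x Fx; exact/subsetPset/ndF/leq_maxl.
    - by move: y Gy; exact/subsetPset/ndG/leq_maxr.
  by move=> [i _ []/= ? ?]; split; exists i.
move=> k; have [mF Fk] := Foo k; have [mG Gk] := Goo k; split.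
  rewrite -[X in measurable X]setTI; apply: measurable_uncons_pair => //.
  exact: measurableX.
rewrite /lebesgue_cons /pushforward -comp_preimage.
rewrite (_ : _ \o _ = id); last by rewrite funeqE; exact: cons_pairK.
by rewrite preimage_id product_measure1E// lte_mul_pinfty// ge0_fin_numE.
Qed.

HB.instance Definition _ := Measure_isSigmaFinite.Build _ _ _ lebesgue_cons
  lebesgue_cons_sigma_finite.

End step.

Fixpoint lebesgue_Rn n : {sigma_finite_measure set (n.-tuple mR) -> \bar R} :=
  match n with
  | 0 => \d_[tuple]
  | n'.+1 => lebesgue_cons (lebesgue_Rn n')
  end.

Lemma lebesgue_Rn_box n (A : 'I_n -> set mR) : (forall i, measurable (A i)) ->
  lebesgue_Rn n [set t | forall i, A i (tnth t i)] =
  (\prod_(i < n) lebesgue_measure (A i))%E.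
Proof.
elim: n A => [|n IH] A mA.
  by rewrite big_ord0 /= diracE mem_set //= => -[].
rewrite big_ord_recl /= /lebesgue_cons /pushforward.
rewrite -IH => [|i]; last exact: mA.
rewrite -product_measure1E //; last first.
  rewrite [X in measurable X](_ : _ =
      \bigcap_(i in [set: 'I_n]) (@tnth n mR ^~ i @^-1` A (lift ord0 i))).
    apply: fin_bigcap_measurable => // i _.
    by rewrite -[X in measurable X]setTI; apply: measurable_tnth.
  by apply/seteqP; split=> [t At i _|t At i]; exact: At.
congr (_ _); apply/seteqP; split=> -[x t] /=.
  by move=> At; split=> [|i]; [exact: (At ord0)|have := At (lift ord0 i); rewrite tnthS].
move=> [Ax At] i; case: (unliftP ord0 i) => [j|] -> //.
by rewrite tnthS; exact: At.
Qed.

End lebesgue_Rn.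

Section analysis_on_Rn.
Context {R : realType} {d : nat}.
Implicit Types (x y : 'rV[R]_d) (f : 'rV[R]_d -> R)
  (u v : 'rV[R]_d -> 'rV[R]_d).

Definition dot x y : R := \sum_(i < d) x 0 i * y 0 i.

(* The library norm on ['rV[R]_d] is the max norm. *)
Definition enorm x : R := Num.sqrt (dot x x).

Definition point_of (t : d.-tuple (measurableTypeR R)) : 'rV[R]_d :=
  \row_i tnth t i.

Definition integral_Rn (D : set 'rV[R]_d) f : R :=
  \int[lebesgue_Rn d]_(t in [set t | D (point_of t)]) f (point_of t).

(* ['D_e f x] is a total operator, with a default value where the directional
   derivative does not exist. The functions differentiated below are smooth
   inside each simplex, so this happens only on a Lebesgue-null set. *)
Definition partial (j : 'I_d) f x : R := 'D_(delta_mx 0 j) f x.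

Definition grad f x : 'rV[R]_d := \row_j partial j f x.

Definition vgrad v x : 'M[R]_d :=
  \matrix_(i, j) partial j (fun y => v y 0 i) x.

Definition strain v x : 'M[R]_d := 2^-1 *: (vgrad v x + (vgrad v x)^T).

Definition div v x : R := \tr (vgrad v x).

Definition ddot (A B : 'M[R]_d) : R := \sum_(i < d) \sum_(j < d) A i j * B i j.

Definition elasticity (Omega : set 'rV[R]_d) (lambda mu : R) u v : R :=
  2 * mu * integral_Rn Omega (fun x => ddot (strain u x) (strain v x)) +
  lambda * integral_Rn Omega (fun x => div u x * div v x).

(* Equality with the interior of the closure excludes slits and other
   pathologies of a mere open connected set, as any Lipschitz assumption on the
   boundary does. Without it, meshing [closure Omega] would not mesh [Omega]. *)
Definition domain (Omega : set 'rV[R]_d) : Prop :=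
  [/\ open Omega, connected Omega, Omega !=set0 &
      (closure Omega)° = Omega].

End analysis_on_Rn.

(* Raw data: vertex positions and, for each simplex, its d + 1 vertices in an
   arbitrary order. Validity is the predicate [triangulation]. *)
Record mesh (R : realType) (d : nat) := Mesh {
  nV : nat;
  nT : nat;
  vtx : 'I_nV -> 'rV[R]_d;
  elt : 'I_nT -> 'I_d.+1 -> 'I_nV
}.

Section mesh_geometry.
Context {R : realType} {d : nat} (M : mesh R d).
Implicit Types (S : {set 'I_(nV M)}) (t : 'I_(nT M)).

Definition cell t : {set 'I_(nV M)} := [set elt t k | k : 'I_d.+1]%SET.

Definition hull S : set 'rV[R]_d :=
  [set x | exists w : 'I_(nV M) -> R,
     [/\ forall i, 0 <= w i, forall i, i \notin S -> w i = 0,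
         \sum_i w i = 1 & x = \sum_i w i *: vtx i]].

Definition simplex t : set 'rV[R]_d := hull (cell t).

(* Row k is (1, k-th vertex of t); it is invertible exactly when the d + 1
   vertices of t are affinely independent. *)
Definition bary_mx t : 'M[R]_(1 + d) :=
  \matrix_(k < 1 + d) row_mx 1%:M (vtx (elt t k)).

(* The solution of [\sum_k bary t k x = 1] and
   [\sum_k bary t k x *: vtx (elt t k) = x]. *)
Definition bary t (k : 'I_d.+1) (x : 'rV[R]_d) : R :=
  (row_mx 1%:M x *m invmx (bary_mx t)) 0 k.

Definition barycenter t : 'rV[R]_d :=
  d.+1%:R^-1 *: \sum_(k < d.+1) vtx (elt t k).

Definition triangulation (Omega : set 'rV[R]_d) : Prop :=
  [/\ injective (@vtx R d M) /\ (forall i, exists t, i \in cell t),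
      forall t, bary_mx t \in unitmx,
      injective cell,
      forall t t', simplex t `&` simplex t' = hull (cell t :&: cell t')%SET &
      closure Omega = \bigcup_t simplex t].

Definition diam t : R :=
  sup [set r | exists x y, [/\ simplex t x, simplex t y & r = enorm (x - y)]].

Definition inradius t : R :=
  sup [set r | 0 <= r /\
    exists c, forall y, enorm (y - c) <= r -> simplex t y].

Definition mesh_size : R := \big[Num.max/0]_(t < nT M) diam t.

Definition shape_regular (sigma : R) : Prop :=
  forall t, diam t <= sigma * inradius t.

Definition quasi_uniform (tau : R) : Prop :=
  forall t, mesh_size <= tau * diam t.

End mesh_geometry.

Section mini_element.
Context {R : realType} {d : nat} (Omega : set 'rV[R]_d) (M : mesh R d).
Implicit Types (t : 'I_(nT M)) (phi : 'I_(nV M) -> 'rV[R]_d -> R).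

Definition affine_on (A : set 'rV[R]_d) (f : 'rV[R]_d -> R) : Prop :=
  exists g c, forall x, A x -> f x = dot g x + c.

Definition P1_space : set ('rV[R]_d -> R) :=
  [set f | {within closure Omega, continuous f} /\
           forall t, affine_on (simplex t) f].

(* This determines each [phi i] on [closure Omega]. *)
Definition nodal_basis phi : Prop :=
  forall i, P1_space (phi i) /\
            forall j, phi i (vtx j) = (i == j)%:R.

Definition stiffness phi : 'M[R]_(nV M) :=
  \matrix_(i, j)
    integral_Rn Omega (fun x => dot (grad (phi j) x) (grad (phi i) x)).

Definition bubble_scale t : R :=
  (\prod_(k < d.+1) bary t k (barycenter t))^-1.

Definition bubble t (x : 'rV[R]_d) : R :=
  \1_(simplex t) x * (bubble_scale t * \prod_(k < d.+1) bary t k x).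

Definition bubble_index := ('I_(nT M) * 'I_d)%type.

Definition vbubble (b : bubble_index) (x : 'rV[R]_d) : 'rV[R]_d :=
  bubble b.1 x *: delta_mx 0 b.2.

Definition A_b (lambda mu : R) : 'M[R]_#|{: bubble_index}| :=
  \matrix_(k, l)
    elasticity Omega lambda mu (vbubble (enum_val l)) (vbubble (enum_val k)).

(* The form (v, grad p), which integration by parts identifies with
   -(div v, p): the bubbles vanish on the boundary of every simplex. *)
Definition G_b phi : 'M[R]_(#|{: bubble_index}|, nV M) :=
  \matrix_(k, i) integral_Rn Omega
    (fun x => dot (vbubble (enum_val k) x) (grad (phi i) x)).

Definition S_b (lambda mu : R) phi : 'M[R]_(nV M) :=
  (G_b phi)^T *m invmx (A_b lambda mu) *m G_b phi.

End mini_element.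

Definition qform (R : realType) n (A : 'M[R]_n) (x : 'cV[R]_n) : R :=
  (x^T *m A *m x) 0 0.

(* Main.v *)
Require Import Defs.
From mathcomp Require Import all_boot all_order all_algebra.
From mathcomp Require Import all_classical all_reals all_analysis.
From mathcomp Require Import measurable_realfun ring lra.
Set Implicit Arguments.
Unset Strict Implicit.
Unset Printing Implicit Defensive.
Import Order.TTheory GRing.Theory Num.Theory.
Import numFieldNormedType.Exports.
Local Open Scope classical_set_scope.
Local Open Scope ring_scope.

(** The bubbles of one simplex do not interact with those of another, so the
    Schur complement is a sum over the simplices. Let [p] be the pressure with
    nodal values [z], whose gradient is a constant [g] on the simplex [t], and
    let [b] be the scalar bubble of [t]. A bubble displacement on [t] is [b v]
    for a constant vector [v]; its elastic energy is the integral of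
    [mu |v|^2 |grad b|^2 + (mu + lambda) (v . grad b)^2], and it is comparable
    to [gamma |v|^2], where [gamma], the integral of [|grad b|^2], is
    [bubble_energy t]. The constants are the smaller and the larger of [mu] and
    [2 mu + lambda], both positive under the assumptions on the Lame
    coefficients. The coupling with [p] is [beta (v . g)], where [beta], the
    integral of [b], is [bubble_mass t]. Inverting ([invmx_energy_bounds]), the
    Schur complement is comparable to the sum of [beta^2 / gamma |g|^2], while
    the Laplace matrix gives exactly the sum of [vol t |g|^2]. What remains is
    the scaling [beta^2 / gamma ~ h^2 vol t] ([bubble_ratio]).

    The scaling is obtained without a reference simplex. Shape regularity and
    quasi-uniformity bound the gradients of the barycentric coordinates by
    [K / h]: a ball inscribed in the simplex has a diameter along which such a
    coordinate varies by at most 1 ([enorm_dbary_inradius]). Hence around the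
    midpoint of a vertex and the barycenter there is a box of side proportional
    to [h] on which all barycentric coordinates stay above a constant
    ([box_bary]). The simplex has diameter at most [h], so the box fills a fixed
    fraction of its volume. On the box the bubble is bounded below, and so is
    [h |grad b|], because the bubble increases along the rays from the vertex
    ([bgrad_radial]). With the obvious upper bounds on the whole simplex, this
    gives [beta ~ vol t] and [h^2 gamma ~ vol t].

    The integrals over the domain reduce to integrals over the interiors of
    the simplices because the faces lie in hyperplanes, which are null sets
    ([integral_Omega]). *)

(** * Functions equal off a null set, and hyperplanes *)

Section null_sets.
Context d (T : measurableType d) (R : realType).
Variable mu : {measure set T -> \bar R}.
Local Open Scope ereal_scope.
Import HBNNSimple.

(** Every simple function below [f], once multiplied by the indicator of the
    complement of [N], lies below [g] and keeps its integral. The lemma is meant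
    for possibly nonmeasurable functions: a total directional derivative takes
    uncontrolled values on the faces of the mesh. *)
Lemma ge0_integral_le_off_null (f g : T -> \bar R) (N : set T) :
  measurable N -> mu N = 0 ->
  (forall x, 0 <= f x) -> (forall x, 0 <= g x) ->
  (forall x, ~ N x -> f x = g x) -> \int[mu]_x f x <= \int[mu]_x g x.
Proof.
move=> mN N0 f0 g0 fg; rewrite !ge0_integralTE//.
apply: ge_ereal_sup => _ [h /= hf <-].
pose k : {nnsfun T >-> R} := proj_nnsfun h (measurableC mN).
have kE x : k x = (h x * \1_(~` N) x)%R by [].
rewrite -integralT_nnsfun.
have -> : \int[mu]_x (h x)%:E = \int[mu]_x (k x)%:E.
  apply: ge0_ae_eq_integral => //.
  - by apply: measurableT_comp => //; exact: measurable_funPTI.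
  - by apply: measurableT_comp => //; exact: measurable_funPTI.
  - by move=> x _; rewrite lee_fin.
  - by move=> x _; rewrite lee_fin.
  exists N; split => // x /= /not_implyP[_] hk; apply: contrapT => Nx; apply: hk.
  rewrite [RHS](_ : _ = (h x * \1_(~` N) x)%:E)//.
  by rewrite indicE mem_set ?mulr1.
rewrite integralT_nnsfun; apply: ereal_sup_ubound; exists k => // x.
rewrite kE indicE; have [/set_mem Nx|_] := boolP (x \in _).
  by rewrite mulr1 -fg.
by rewrite mulr0.
Qed.

Lemma integral_eq_off_null (f g : T -> \bar R) (N : set T) :
  measurable N -> mu N = 0 -> (forall x, ~ N x -> f x = g x) ->
  \int[mu]_x f x = \int[mu]_x g x.
Proof.
move=> mN N0 fg; rewrite [LHS]integralE [RHS]integralE; congr (_ - _);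
  apply/eqP; rewrite eq_le; apply/andP; split;
  apply: (@ge0_integral_le_off_null _ _ N) => // x Nx;
  by rewrite ?funeposE ?funenegE fg.
Qed.

End null_sets.

Section hyperplanes.
Context {R : realType}.
Local Notation mR := (measurableTypeR R).

Lemma measurable_affine n (a : 'I_n -> R) (c : R) :
  measurable_fun setT (fun t : n.-tuple mR => \sum_i a i * tnth t i + c).
Proof.
apply: measurable_funD => //; apply: measurable_sum => i.
by apply: measurable_funM => //; exact: measurable_tnth.
Qed.

(** Slice along the first coordinate. If some later coefficient is nonzero, all
    slices are hyperplanes of lower dimension; otherwise the set is a point
    times a space, and the product measure of that is zero. *)
Lemma hyperplane_null n (a : 'I_n -> R) (c : R) (i0 : 'I_n) : a i0 != 0 ->
  lebesgue_Rn n [set t | \sum_i a i * tnth t i + c = 0] = 0%E.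
Proof.
elim: n a c i0 => [a c []//|n IH a c i0 ai0].
rewrite /= /lebesgue_cons /pushforward.
set B := _ @^-1` _.
have BE p : B p = (a ord0 * p.1 +
    (\sum_i a (lift ord0 i) * tnth p.2 i) + c = 0).
  case: p => x t; rewrite /B /= big_ord_recl (tnth_nth 0) /=.
  by under eq_bigr do rewrite tnthS.
have [[j aj]|a0] := pselect (exists j, a (lift ord0 j) != 0).
  rewrite /product_measure1; apply: integral0_eq => x _ /=.
  rewrite (_ : xsection B x = [set t | \sum_i a (lift ord0 i) * tnth t i +
    (a ord0 * x + c) = 0]); first exact: IH aj.
  apply/seteqP; split=> t; rewrite /xsection /= inE BE /= => e; rewrite -[RHS]e; ring.
have al j : a (lift ord0 j) = 0.
  by apply/eqP; apply: contrapT => aj; apply: a0; exists j; apply/negP.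
have a00 : a ord0 != 0.
  by move: ai0; case: (unliftP ord0 i0) => [j|] ->//; rewrite al eqxx.
have -> : B = [set - c / a ord0] `*` setT.
  apply/seteqP; split=> -[x t]; rewrite BE /= big1.
  - move=> e; split => //; apply: (mulfI a00).
    by rewrite mulrCA mulfV// mulr1; apply/eqP; rewrite -addr_eq0 -[_ * _]addr0 e.
  - by move=> i _; rewrite al mul0r.
  - by move=> [-> _]; rewrite addr0 mulrCA mulfV// mulr1 addNr.
  - by move=> i _; rewrite al mul0r.
rewrite product_measure1E//.
have /= -> := lebesgue_measure_set1 (- c / a ord0).
by rewrite mul0e.
Qed.

End hyperplanes.

(** * Integration over regions of the Euclidean space *)

Section regions.
Context {R : realType} {d : nat}.
Local Notation mR := (measurableTypeR R).
Local Notation mu := (lebesgue_Rn (R := R) d).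
Implicit Types (D Omega : set 'rV[R]_d) (F G : 'rV[R]_d -> R).

Definition coords D : set (d.-tuple mR) := [set t | D (point_of t)].

(** The sets over which bounded functions can be integrated. *)
Definition region D := measurable (coords D) /\ (mu (coords D) < +oo)%E.

Definition vol D : R := fine (mu (coords D)).

(** A measurable function on the whole space that is bounded on [D]; on a
    region this gives integrability, and it passes to sums and products, so
    that every polynomial integrand below is covered. *)
Definition bounded_on D F := measurable_fun setT (F \o @point_of R d) /\
  exists C, forall x, D x -> `|F x| <= C.

Lemma bounded_on_cst D c : bounded_on D (fun=> c).
Proof. by split; [exact: measurable_cst|exists `|c|]. Qed.

Lemma bounded_onD D F G : bounded_on D F -> bounded_on D G ->
  bounded_on D (fun x => F x + G x).
Proof.
move=> [mF [C FC]] [mG [C' GC]]; split; first exact: measurable_funD.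
by exists (C + C') => x Dx; rewrite (le_trans (ler_normD _ _))// lerD ?FC ?GC.
Qed.

Lemma bounded_onM D F G : bounded_on D F -> bounded_on D G ->
  bounded_on D (fun x => F x * G x).
Proof.
move=> [mF [C FC]] [mG [C' GC]]; split; first exact: measurable_funM.
by exists (C * C') => x Dx; rewrite normrM ler_pM ?FC ?GC.
Qed.

Lemma bounded_onZ D c F : bounded_on D F -> bounded_on D (fun x => c * F x).
Proof. exact/bounded_onM/bounded_on_cst. Qed.

Lemma bounded_on_sum D (I : Type) (r : seq I) (P : pred I)
    (F : I -> 'rV[R]_d -> R) : (forall i, bounded_on D (F i)) ->
  bounded_on D (fun x => \sum_(i <- r | P i) F i x).
Proof.
move=> bF; elim: r => [|i r IH].
  by under eq_fun do rewrite big_nil; exact: bounded_on_cst.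
under eq_fun do rewrite big_cons; case: (P i) => //; exact: bounded_onD.
Qed.

Lemma bounded_on_prod D (I : Type) (r : seq I) (P : pred I)
    (F : I -> 'rV[R]_d -> R) : (forall i, bounded_on D (F i)) ->
  bounded_on D (fun x => \prod_(i <- r | P i) F i x).
Proof.
move=> bF; elim: r => [|i r IH].
  by under eq_fun do rewrite big_nil; exact: bounded_on_cst.
under eq_fun do rewrite big_cons; case: (P i) => //; exact: bounded_onM.
Qed.

Lemma bounded_on_integrable D F : region D -> bounded_on D F ->
  mu.-integrable (coords D) (EFin \o (F \o @point_of R d)).
Proof.
move=> [mD fD] [mF [C FC]]; apply: measurable_bounded_integrable => //.
  exact: measurable_funS mF.
exists C; split; first exact: num_real.
by move=> y Cy t Dt; apply: le_trans (ltW Cy); exact: FC.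
Qed.

Lemma integral_RnZ D c F : region D -> bounded_on D F ->
  integral_Rn D (fun x => c * F x) = c * integral_Rn D F.
Proof.
by move=> rD bF; apply: RintegralZl; [case: rD|exact: bounded_on_integrable].
Qed.

Lemma integral_RnD D F G : region D -> bounded_on D F -> bounded_on D G ->
  integral_Rn D (fun x => F x + G x) = integral_Rn D F + integral_Rn D G.
Proof.
move=> rD bF bG.
by apply: RintegralD; [case: rD|exact: bounded_on_integrable..].
Qed.

Lemma integral_Rn_cst D c : region D -> integral_Rn D (fun=> c) = c * vol D.
Proof. by case=> mD _; exact: Rintegral_cst. Qed.

Lemma integral_Rn_sum D (I : Type) (r : seq I) (P : pred I)
    (F : I -> 'rV[R]_d -> R) : region D -> (forall i, bounded_on D (F i)) ->
  integral_Rn D (fun x => \sum_(i <- r | P i) F i x) =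
  \sum_(i <- r | P i) integral_Rn D (F i).
Proof.
move=> rD bF; elim: r => [|i r IH].
  rewrite big_nil; under [in LHS]eq_fun do rewrite big_nil.
  by rewrite integral_Rn_cst// mul0r.
rewrite big_cons; under [in LHS]eq_fun do rewrite big_cons.
case: (P i) => //; rewrite integral_RnD ?IH//; exact: bounded_on_sum.
Qed.

Lemma eq_integral_Rn D F G : (forall x, D x -> F x = G x) ->
  integral_Rn D F = integral_Rn D G.
Proof. by move=> FG; apply: eq_Rintegral => t /set_mem; exact: FG. Qed.

Lemma le_integral_Rn D F G : region D -> bounded_on D F -> bounded_on D G ->
  (forall x, D x -> F x <= G x) -> integral_Rn D F <= integral_Rn D G.
Proof.
move=> rD bF bG FG.
by apply: le_Rintegral; [case: rD|exact: bounded_on_integrable..|move=> t; exact: FG].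
Qed.

Lemma integral_Rn_ge0 D F : (forall x, D x -> 0 <= F x) -> 0 <= integral_Rn D F.
Proof. by move=> F0; apply: Rintegral_ge0 => t; exact: F0. Qed.

Lemma le_vol D D' : region D' -> measurable (coords D) -> D `<=` D' ->
  region D /\ vol D <= vol D'.
Proof.
move=> [mD' fD'] mD DD'.
have le : (mu (coords D) <= mu (coords D'))%E.
  by apply: le_measure; rewrite ?inE//; move=> t; exact: DD'.
have fD : (mu (coords D) < +oo)%E by exact: le_lt_trans fD'.
by split => //; rewrite fine_le// ge0_fin_numE.
Qed.

Lemma integral_Rn_ge D B F c : region D -> region B -> B `<=` D ->
  bounded_on D F -> (forall x, D x -> 0 <= F x) ->
  (forall x, B x -> c <= F x) -> c * vol B <= integral_Rn D F.
Proof.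
move=> rD rB BD bF F0 Fc.
have bF' : bounded_on B F.
  by case: bF => mF [C FC]; split => //; exists C => x /BD; exact: FC.
rewrite -integral_Rn_cst// (@le_trans _ _ (integral_Rn B F))//.
  by apply: le_integral_Rn => //; exact: bounded_on_cst.
have [iF iF'] := (bounded_on_integrable rD bF, bounded_on_integrable rB bF').
have [[mD _] [mB _]] := (rD, rB).
rewrite /integral_Rn /Rintegral fine_le//.
- exact: (integrable_fin_num mB iF').
- exact: (integrable_fin_num mD iF).
apply: ge0_subset_integral => //.
- by case/integrableP: iF.
- by move=> t Dt; rewrite lee_fin F0.
- by move=> t; exact: BD.
Qed.

Definition box (p : 'rV[R]_d) (r : R) : set 'rV[R]_d :=
  [set x | forall i, `|x 0 i - p 0 i| <= r].

Lemma box_vol p r : 0 <= r -> region (box p r) /\ vol (box p r) = (r *+ 2) ^+ d.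
Proof.
move=> r0; pose A i : set mR := [set` `[p 0 i - r, p 0 i + r]].
have boxE : coords (box p r) = [set t | forall i, A i (tnth t i)].
  apply/seteqP; split=> t bt i; have := bt i; rewrite /A /= mxE in_itv /=;
  by rewrite ler_distl.
have muE : mu (coords (box p r)) = ((r *+ 2) ^+ d)%:E.
  transitivity (\prod_(i < d) (r *+ 2)%:E)%E; last first.
    by rewrite prodEFin prodr_const card_ord.
  rewrite boxE lebesgue_Rn_box => [|i]; last exact: measurable_itv.
  apply: eq_bigr => i _; have /= -> := @lebesgue_measure_itv R `[p 0 i - r, p 0 i + r].
  rewrite lte_fin -EFinB; case: ltP => h; congr _%:E; lra.
split; last by rewrite /vol muE.
split; last by rewrite muE ltry.
rewrite boxE (_ : [set t | _] =
    \bigcap_(i in [set: 'I_d]) (@tnth d mR ^~ i @^-1` A i)).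
  apply: fin_bigcap_measurable => // i _.
  by rewrite -[X in measurable X]setTI; apply: measurable_tnth => //; exact: measurable_itv.
by apply/seteqP; split=> [t At i _|t At i]; exact: At.
Qed.

(** Off the null set [N] the pieces [D i] tile [Omega], and [f] coincides there
    with a function that is integrable on each piece. *)
Lemma integral_Rn_pieces (I : finType) Omega (D : I -> set 'rV[R]_d) N f
    (F : I -> 'rV[R]_d -> R) :
  measurable N -> mu N = 0%E ->
  (forall i, region (D i)) -> (forall i, bounded_on (D i) (F i)) ->
  (forall i, D i `<=` Omega) -> (forall i j x, D i x -> D j x -> i = j) ->
  (forall t, ~ N t -> Omega (point_of t) -> exists i, D i (point_of t)) ->
  (forall i x, D i x -> f x = F i x) ->
  integral_Rn Omega f = \sum_i integral_Rn (D i) (F i).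
Proof.
move=> mN N0 rD bF DO Ddis Dcov fF.
pose g i := (EFin \o (F i \o @point_of R d)) \_ (coords (D i)).
have ig i : mu.-integrable setT (g i).
  have [mDi _] := rD i; have := bounded_on_integrable (rD i) (bF i).
  by rewrite (integrable_mkcond _ mDi).
rewrite /integral_Rn /Rintegral integral_mkcond.
rewrite (@integral_eq_off_null _ _ _ _ _ (fun t => \sum_i g i t)%E N)//.
  rewrite integral_sum// -sum_fine => [|i _]; last exact: integrable_fin_num.
  by apply: eq_bigr => i _; rewrite [in RHS]integral_mkcond.
move=> t Nt; rewrite /g /patch.
have [/set_mem Ot|Ot] := boolP (t \in _); last first.
  rewrite big1// => i _; case: ifPn => // /set_mem Dt.
  by move/negP: Ot; case; apply/mem_set; exact: DO Dt.
have [i Di] := Dcov t Nt Ot.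
rewrite (bigD1 i)//= mem_set// big1 ?adde0 ?(fF i)// => j ji.
case: ifPn => // /set_mem Dj; by rewrite (Ddis _ _ _ Di Dj) eqxx in ji.
Qed.

End regions.

(** * Inverse of a matrix comparable to a diagonal matrix *)

Section inverse_energy.
Context {R : realType}.

Lemma qform_conjugate m n (G : 'M[R]_(m, n)) (A : 'M[R]_m) x :
  qform (G^T *m A *m G) x = qform A (G *m x).
Proof. by rewrite /qform trmx_mul !mulmxA. Qed.

Lemma qformE n (A : 'M[R]_n) x :
  qform A x = \sum_i \sum_j x i 0 * x j 0 * A i j.
Proof.
rewrite /qform mxE exchange_big /=; apply: eq_bigr => j _.
rewrite mxE mulr_suml; apply: eq_bigr => i _; rewrite mxE; ring.
Qed.

(** If [A] is comparable to the diagonal matrix of [w], then [invmx A] is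
    comparable to the inverse diagonal matrix. The number [qform (invmx A) b] is
    the maximum over [z] of [2 b^T z - qform A z], and the lower bound evaluates
    this at a suitable [z]. The upper bound is Young's inequality for [b^T y]
    with [y = invmx A *m b], since [b^T y = qform A y]. *)
Lemma invmx_energy_bounds n (A : 'M[R]_n) (w : 'I_n -> R) (k0 k1 : R) :
  0 < k0 -> 0 < k1 -> (forall i, 0 < w i) -> A^T = A ->
  (forall z : 'cV_n, k0 * \sum_i w i * z i 0 ^+ 2 <= qform A z
                      <= k1 * \sum_i w i * z i 0 ^+ 2) ->
  forall b : 'cV_n,
    k1^-1 * \sum_i b i 0 ^+ 2 / w i <= qform (invmx A) b
      <= k0^-1 * \sum_i b i 0 ^+ 2 / w i.
Proof.
move=> k0_gt0 k1_gt0 w_gt0 Asym bnd b.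
have Aunit : A \in unitmx.
  rewrite unitmxE unitfE; apply/negP => /det0P[v v0 vA0].
  have [i vi] : exists i, v 0 i != 0 by exact/rV0Pn.
  have /andP[+ _] := bnd v^T; rewrite /qform trmxK vA0 mul0mx mxE.
  apply/negP; rewrite -ltNge pmulr_rgt0//.
  rewrite (bigD1 i)//= ltr_pwDl//.
    by rewrite mulr_gt0// mxE exprn_even_gt0.
  by apply: sumr_ge0 => j _; rewrite mulr_ge0 ?sqr_ge0// ltW.
pose y := invmx A *m b; have Ay : A *m y = b by rewrite mulKVmx.
pose s := qform (invmx A) b; pose B := \sum_i b i 0 ^+ 2 / w i.
have sb : s = \sum_i b i 0 * y i 0.
  by rewrite /s /qform -mulmxA -/y mxE; apply: eq_bigr => i _; rewrite [b^T _ _]mxE.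
have sy : s = qform A y.
  rewrite /qform -mulmxA Ay mxE sb; apply: eq_bigr => i _.
  by rewrite [y^T _ _]mxE mulrC.
rewrite -/s -/B; apply/andP; split.
  (* The maximizer for the diagonal matrix [k1 * w]. *)
  pose z : 'cV[R]_n := \col_i (b i 0 / (k1 * w i)).
  have zb : \sum_i b i 0 * z i 0 = k1^-1 * B.
    rewrite /B mulr_sumr; apply: eq_bigr => i _; rewrite mxE.
    by field; rewrite !gt_eqF.
  have zw : k1 * \sum_i w i * z i 0 ^+ 2 = k1^-1 * B.
    rewrite /B !mulr_sumr; apply: eq_bigr => i _; rewrite mxE.
    by field; rewrite !gt_eqF.
  have : 0 <= qform A (y - z).
    have /andP[+ _] := bnd (y - z); apply: le_trans.
    rewrite mulr_ge0 ?(ltW k0_gt0)//; apply: sumr_ge0 => i _.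
    by rewrite mulr_ge0 ?sqr_ge0 ?ltW.
  have -> : qform A (y - z) = s - 2 * (k1^-1 * B) + qform A z.
    have entryB (a c : 'M[R]_1) : (a - c) 0 0 = a 0 0 - c 0 0 by rewrite !mxE.
    have -> : qform A (y - z) = (qform A y - ((y^T *m A) *m z) 0 0) -
        (((z^T *m A) *m y) 0 0 - qform A z).
      have trB : (y - z)^T = y^T - z^T by rewrite linearB.
      by rewrite /qform trB !mulmxBl !mulmxBr !entryB; ring.
    have -> : ((z^T *m A) *m y) 0 0 = \sum_i b i 0 * z i 0.
      by rewrite -mulmxA Ay mxE; apply: eq_bigr => i _; rewrite [z^T _ _]mxE mulrC.
    have -> : ((y^T *m A) *m z) 0 0 = \sum_i b i 0 * z i 0.
      by rewrite -{1}Asym -trmx_mul Ay mxE; apply: eq_bigr => i _; rewrite [b^T _ _]mxE.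
    by rewrite sy -zb; ring.
  by have /andP[_] := bnd z; rewrite zw; lra.
have : 2 * s <= k0^-1 * B + k0 * \sum_i w i * y i 0 ^+ 2.
  rewrite sb /B !mulr_sumr -big_split /=; apply: ler_sum => i _.
  rewrite -subr_ge0 (_ : _ - _ =
    (k0 * w i)^-1 * (b i 0 - k0 * w i * y i 0) ^+ 2).
    by rewrite mulr_ge0 ?sqr_ge0// invr_ge0 mulr_ge0 ?ltW.
  by field; rewrite !gt_eqF.
by have /andP[+ _] := bnd y; rewrite -sy; lra.
Qed.

End inverse_energy.

(** * Barycentric coordinates *)

Section euclidean_space.
Context {R : realType} {d : nat}.
Implicit Types (x y z : 'rV[R]_d).

Lemma dotDr x y z : dot x (y + z) = dot x y + dot x z.
Proof. by rewrite /dot -big_split; apply: eq_bigr => i _; rewrite mxE mulrDr. Qed.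

Lemma dotZr x a y : dot x (a *: y) = a * dot x y.
Proof. by rewrite /dot mulr_sumr; apply: eq_bigr => i _; rewrite mxE mulrCA. Qed.

Lemma dotC x y : dot x y = dot y x.
Proof. by apply: eq_bigr => i _; rewrite mulrC. Qed.

Lemma dotBr x y z : dot x (y - z) = dot x y - dot x z.
Proof. by rewrite -scaleN1r dotDr dotZr mulN1r. Qed.

Lemma dot0r x : dot x 0 = 0.
Proof. by rewrite /dot big1// => i _; rewrite mxE mulr0. Qed.

Lemma dot_sumr (I : Type) (r : seq I) (P : pred I) x (F : I -> 'rV[R]_d) :
  dot x (\sum_(i <- r | P i) F i) = \sum_(i <- r | P i) dot x (F i).
Proof. by elim/big_rec2: _ => [|i a b _ <-]; rewrite (dot0r, dotDr). Qed.

Lemma dot_ge0 x : 0 <= dot x x.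
Proof. by apply: sumr_ge0 => i _; rewrite -expr2 sqr_ge0. Qed.

Lemma enorm_ge0 x : 0 <= enorm x.
Proof. exact: sqrtr_ge0. Qed.

Lemma sqr_enorm x : enorm x ^+ 2 = dot x x.
Proof. by rewrite sqr_sqrtr// dot_ge0. Qed.

Lemma enormZ a x : enorm (a *: x) = `|a| * enorm x.
Proof.
by rewrite /enorm dotZr dotC dotZr mulrA -expr2 sqrtrM ?sqr_ge0// sqrtr_sqr.
Qed.

Lemma enormN x : enorm (- x) = enorm x.
Proof. by rewrite -scaleN1r enormZ normrN1 mul1r. Qed.

Lemma coord_le_enorm x i : `|x 0 i| <= enorm x.
Proof.
rewrite -sqrtr_sqr ler_wsqrtr// /dot (bigD1 i)//= -expr2 lerDl.
by apply: sumr_ge0 => j _; rewrite -expr2 sqr_ge0.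
Qed.

Lemma dot_CauchySchwarz x y : dot x y ^+ 2 <= dot x x * dot y y.
Proof.
have [y0|y0] := eqVneq (dot y y) 0.
  have yi i : y 0 i = 0.
    have := coord_le_enorm y i; rewrite /enorm y0 sqrtr0 normr_le0.
    by move/eqP.
  by rewrite y0 mulr0 /dot big1 ?expr0n// => i _; rewrite yi mulr0.
have y_gt0 : 0 < dot y y by rewrite lt_neqAle eq_sym y0 dot_ge0.
have := dot_ge0 (dot y y *: x - dot x y *: y).
rewrite dotBr !dotZr ![dot (_ - _) _]dotC !dotBr !dotZr (dotC y x) => h.
rewrite -subr_ge0 -(pmulr_rge0 _ y_gt0); apply: le_trans h _.
by rewrite le_eqVlt; apply/orP; left; apply/eqP; ring.
Qed.

Lemma dot_le_enorm x y : dot x y <= enorm x * enorm y.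
Proof.
rewrite (le_trans (ler_norm _))// -ler_sqr ?nnegrE ?mulr_ge0 ?enorm_ge0//.
rewrite real_normK ?num_real// exprMn !sqr_enorm; exact: dot_CauchySchwarz.
Qed.

Lemma dot_delta x j : dot x (delta_mx 0 j) = x 0 j.
Proof.
rewrite /dot (bigD1 j)//= mxE !eqxx mulr1 big1 ?addr0// => i ij.
by rewrite mxE (negbTE ij) andbF mulr0.
Qed.

Lemma dot_deltal x j : dot (delta_mx 0 j) x = x 0 j.
Proof. by rewrite dotC dot_delta. Qed.

End euclidean_space.

Section simplex_geometry.
Context {R : realType} {d : nat} (M : mesh R d).
Implicit Types (t : 'I_(nT M)) (x y : 'rV[R]_d) (k l : 'I_d.+1).

(** The constant gradient of the barycentric coordinate of index [k]. *)
Definition dbary t k : 'rV[R]_d :=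
  \row_j invmx (bary_mx t) (rshift 1 j) k.

Lemma bary_affine t k x :
  bary t k x = dot (dbary t k) x + invmx (bary_mx t) (lshift d 0) k.
Proof.
rewrite /bary mxE big_split_ord /= big_ord1 row_mxEl mxE eqxx mulr1n mul1r.
rewrite addrC; congr (_ + _); apply: eq_bigr => j _.
by rewrite row_mxEr mxE mulrC.
Qed.

Lemma baryB t k x y : bary t k x - bary t k y = dot (dbary t k) (x - y).
Proof. by rewrite !bary_affine dotBr; ring. Qed.

Lemma bary_point_of t k (y : d.-tuple (measurableTypeR R)) :
  bary t k (point_of y) =
  \sum_j dbary t k 0 j * tnth y j + invmx (bary_mx t) (lshift d 0) k.
Proof.
rewrite bary_affine; congr (_ + _).
by apply: eq_bigr => j _; rewrite [point_of _ _ _]mxE.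
Qed.

Lemma bary_combination t k (I : finType) (w : I -> R) (p : I -> 'rV[R]_d) :
  \sum_i w i = 1 ->
  bary t k (\sum_i w i *: p i) = \sum_i w i * bary t k (p i).
Proof.
move=> w1; rewrite bary_affine dot_sumr.
rewrite -[X in _ + X]mul1r -w1 mulr_suml -big_split /=.
by apply: eq_bigr => i _; rewrite dotZr bary_affine mulrDr.
Qed.

Section affinely_independent.
Variable t : 'I_(nT M).
Hypothesis unit_t : bary_mx t \in unitmx.

Lemma bary_reconstruct x : row_mx 1%:M x =
  row_mx (\sum_k bary t k x)%:M (\sum_k bary t k x *: vtx (elt t k)).
Proof.
rewrite -{1}(mulmxKV unit_t (row_mx 1%:M x)) mulmx_sum_row.
have -> : (\sum_k bary t k x)%:M = \sum_k bary t k x *: (1%:M : 'M[R]_1).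
  by rewrite -scaler_suml scalemx1.
rewrite [RHS](_ : _ = \sum_(k < 1 + d) bary t k x *:
    row_mx 1%:M (vtx (elt t k))).
  by apply: eq_bigr => k _; rewrite rowK.
elim/big_rec3: _ => [|k a b c _ <-]; first by rewrite row_mx0.
by rewrite scale_row_mx add_row_mx.
Qed.

Lemma bary_sum1 x : \sum_k bary t k x = 1.
Proof.
have /eq_row_mx[/(congr1 (fun A : 'M[R]_1 => A 0 0)) + _] := bary_reconstruct x.
by rewrite !mxE eqxx !mulr1n.
Qed.

Lemma sum_bary_vtx x : \sum_k bary t k x *: vtx (elt t k) = x.
Proof. by have /eq_row_mx[_ <-] := bary_reconstruct x. Qed.

Lemma bary_elt k l : bary t k (vtx (elt t l)) = (k == l)%:R.
Proof.
rewrite /bary -(rowK (fun k => row_mx 1%:M (vtx (elt t k))) l) -row_mul.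
by rewrite mulmxV// mxE mxE eq_sym.
Qed.

Lemma elt_inj : injective (elt t).
Proof.
move=> k l kl; have := bary_elt k l; rewrite -kl bary_elt eqxx.
by case: eqVneq => // _ /eqP; rewrite oner_eq0.
Qed.

Lemma bary_vtx k i : i \in cell t -> bary t k (vtx i) = (elt t k == i)%:R.
Proof.
by move=> /imsetP[l _ ->]; rewrite bary_elt (inj_eq elt_inj).
Qed.

(** Through [hull_bary] the conformity of the mesh becomes usable: a point of a
    proper face has a vanishing barycentric coordinate. *)
Lemma hull_bary (S : {set 'I_(nV M)}) x k : S \subset cell t ->
  hull S x -> 0 <= bary t k x /\ (elt t k \notin S -> bary t k x = 0).
Proof.
move=> St [w [w0 wS w1 ->]]; rewrite bary_combination//.
suff -> : \sum_i w i * bary t k (vtx i) = w (elt t k) by split=> // /wS.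
rewrite (bigD1 (elt t k))//= bary_elt eqxx mulr1 big1 ?addr0// => i ki.
have [iS|/wS->] := boolP (i \in S); last by rewrite mul0r.
rewrite bary_vtx; last exact: (fintype.subsetP St _ iS).
by rewrite eq_sym (negbTE ki) mulr0.
Qed.

Lemma simplexP x : simplex t x <-> forall k, 0 <= bary t k x.
Proof.
split=> [sx k|bx]; first by have [] := hull_bary k (subxx _) sx.
pose w i := \sum_(k | elt t k == i) bary t k x.
exists w; split.
- by move=> i; apply: sumr_ge0.
- move=> i it; rewrite /w big1// => k /eqP ki.
  by case/negP: it; rewrite -ki; apply: imset_f.
- rewrite -(bary_sum1 x) /w.
  by rewrite [RHS](partition_big (elt t) xpredT).
rewrite -{1}(sum_bary_vtx x) (partition_big (elt t) xpredT)//=.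
by apply: eq_bigr => i _; rewrite /w scaler_suml; apply: eq_bigr => k /eqP ->.
Qed.

Lemma bary_le1 k x : simplex t x -> bary t k x <= 1.
Proof.
move=> /simplexP bx; rewrite -(bary_sum1 x) (bigD1 k)//= lerDl.
exact: sumr_ge0.
Qed.

Lemma simplex_elt k : simplex t (vtx (elt t k)).
Proof. by apply/simplexP => l; rewrite bary_elt ler0n. Qed.

Lemma dist_vtx_bary k l x :
  dot (dbary t k) (x - vtx (elt t l)) = bary t k x - (k == l)%:R.
Proof. by rewrite -baryB bary_elt. Qed.

End affinely_independent.
End simplex_geometry.

(** * Interiors, diameters and inradii of simplices *)

Section cell_interior.
Context {R : realType} {d : nat} (M : mesh R d).
Implicit Types (t : 'I_(nT M)) (x y : 'rV[R]_d) (k l : 'I_d.+1).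

(** The interior of the simplex [t]. All integrands are polynomial there, and
    these sets tile the domain up to a null set. *)
Definition icell t : set 'rV[R]_d := [set x | forall k, 0 < bary t k x].

Lemma continuous_bary t k : continuous (bary t k).
Proof.
rewrite (_ : bary t k = fun x =>
    \sum_j dbary t k 0 j * x 0 j + invmx (bary_mx t) (lshift d 0) k); last first.
  by apply/funext => x; rewrite bary_affine.
have Cr r : continuous (fun x : 'rV[R]_d => \sum_(j <- r) dbary t k 0 j * x 0 j).
  elim: r => [|j r IH] x.
    by rewrite (_ : (fun _ => _) = fun=> 0);
      [exact: cst_continuous|apply/funext => y; rewrite big_nil].
  rewrite (_ : (fun _ => _) = fun y : 'rV[R]_d => dbary t k 0 j * y 0 j +
    \sum_(j <- r) dbary t k 0 j * y 0 j); last first.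
    by apply/funext => y; rewrite big_cons.
  apply: (@cvgD R R _ (nbhs x)); last exact: IH.
  by apply: (@cvgM R _ (nbhs x)); [exact: cvg_cst|exact: coord_continuous].
by move=> x; apply: (@cvgD R R _ (nbhs x)); [exact: Cr|exact: cvg_cst].
Qed.

Lemma icell_near t x : icell t x -> \forall y \near x, icell t y.
Proof.
move=> tx; apply: (@filter_forall _ _ _ (nbhs x)) => k.
by apply: (cvgr_gt (bary t k x)) => //; exact: continuous_bary.
Qed.

Lemma measurable_icell t : measurable (coords (icell t)).
Proof.
rewrite (_ : coords (icell t) = \bigcap_(k in [set: 'I_d.+1])
  ((fun y : d.-tuple (measurableTypeR R) =>
      \sum_j dbary t k 0 j * tnth y j + invmx (bary_mx t) (lshift d 0) k)
     @^-1` `]0, +oo[)).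
  apply: fin_bigcap_measurable => // k _; rewrite -[X in measurable X]setTI.
  by apply: measurable_affine => //; exact: measurable_itv.
apply/seteqP; split=> [y ty k _|y ty k].
  by have := ty k; rewrite bary_point_of /= in_itv /= andbT.
by have := ty k Logic.I; rewrite bary_point_of /= in_itv /= andbT.
Qed.

Lemma icell_simplex t : bary_mx t \in unitmx -> icell t `<=` simplex t.
Proof. by move=> ut x tx; apply/(simplexP ut) => k; exact/ltW/tx. Qed.

Lemma simplex_bounded t : exists C, forall x : 'rV[R]_d, simplex t x ->
  forall j : 'I_d, `|x 0 j| <= C.
Proof.
exists (\sum_(j < d) \sum_i `|@vtx _ _ M i 0 j|) => x [w [w0 _ w1 ->]] j.
rewrite (bigD1 j)//=; apply: (@le_trans _ _ (\sum_(i < nV M) `|vtx i 0 j|)); last first.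
  by rewrite lerDl; apply: sumr_ge0 => *; apply: sumr_ge0.
rewrite summxE (le_trans (ler_norm_sum _ _ _))//; apply: ler_sum => i _.
rewrite mxE normrM ger0_norm// ler_piMl//.
by rewrite -w1 (bigD1 i)//= lerDl sumr_ge0.
Qed.

Lemma icell_region t : bary_mx t \in unitmx -> region (icell t).
Proof.
move=> ut; have [C tC] := simplex_bounded t.
have TB : icell t `<=` box 0 `|C|.
  move=> x /(icell_simplex ut)/tC xC i; rewrite mxE subr0.
  by apply: le_trans (xC i) _; exact: ler_norm.
have [rB _] := box_vol (0 : 'rV[R]_d) (normr_ge0 C).
by have [] := le_vol rB (measurable_icell t) TB.
Qed.

Lemma enorm_le_diam t x y : simplex t x -> simplex t y -> enorm (x - y) <= diam t.
Proof.
move=> tx ty; apply: ub_le_sup; last by exists x, y.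
have [C tC] := simplex_bounded t.
exists (Num.sqrt (\sum_(j < d) (C + C) ^+ 2)) => _ [x' [y' [tx' ty' ->]]].
rewrite ler_wsqrtr//; apply: ler_sum => j _.
rewrite -expr2 -real_normK ?num_real// ler_sqr ?nnegrE//; last first.
  by rewrite addr_ge0// (le_trans _ (tC _ tx j)).
by rewrite !mxE (le_trans (ler_normB _ _))// lerD// tC.
Qed.

(** A ball inside the simplex has a diameter parallel to the gradient of a
    barycentric coordinate, along which that coordinate grows by at most 1. *)
Lemma enorm_dbary_inradius t k : bary_mx t \in unitmx -> (0 < d)%N ->
  0 <= inradius t /\ enorm (dbary t k) * inradius t <= 1.
Proof.
move=> ut d0; set g := dbary t k.
have [l kl] : exists l, k != l.
  case: (eqVneq k 0) => [->|k0]; last by exists 0.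
  by exists ord_max; rewrite -val_eqE /= eq_sym -lt0n.
have g0 : 0 < enorm g.
  rewrite lt_neqAle enorm_ge0 andbT; apply/eqP => g0.
  have := dot_le_enorm g (vtx (elt t k) - vtx (elt t l)).
  by rewrite -g0 mul0r -baryB !bary_elt// eqxx (negbTE kl) subr0 ler10.
pose E := [set r : R | 0 <= r /\
    exists c, forall y, enorm (y - c) <= r -> simplex t y].
have ubE : ubound E (enorm g)^-1.
  move=> r [r0 [c cr]]; rewrite -[leRHS]mul1r ler_pdivlMr//.
  pose u := (r / enorm g) *: g.
  have nu : enorm u <= r.
    by rewrite enormZ ger0_norm ?divr_ge0 ?enorm_ge0// divfK// gt_eqF.
  have cu : simplex t (c + u) by apply: cr; rewrite addrAC subrr add0r.
  have cv : simplex t (c - u) by apply: cr; rewrite addrAC subrr add0r enormN.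
  have := bary_le1 ut k cu; have := (simplexP ut _).1 cv k.
  have := baryB t k (c + u) (c - u); rewrite -/g.
  rewrite (_ : c + u - (c - u) = 2 *: u); last first.
    by rewrite scaler_nat mulr2n opprB addrC subrKA.
  rewrite !dotZr -sqr_enorm expr2 [_ / _ * _]mulrA divfK ?gt_eqF// => e h1 h2.
  by rewrite -(@ler_pM2l _ 2)//; lra.
have E0 : E 0.
  split=> //; exists (vtx (elt t k)) => y yk.
  suff -> : y = vtx (elt t k) by exact: simplex_elt.
  apply/rowP => j; apply/eqP; rewrite -subr_eq0 -normr_le0.
  by apply: le_trans yk; rewrite (le_trans _ (coord_le_enorm _ j))// !mxE.
have -> : inradius t = sup E by [].
split; first by apply: ub_le_sup => //; exists (enorm g)^-1.
rewrite mulrC -ler_pdivlMr// mul1r; apply: ge_sup => //; by exists 0.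
Qed.

End cell_interior.

Section mesh_sizes.
Context {R : realType} {d : nat} (M : mesh R d) (sigma tau : R).
Hypothesis d_gt0 : (0 < d)%N.
Hypothesis unitM : forall t : 'I_(nT M), bary_mx t \in unitmx.
Hypothesis shapeM : shape_regular M sigma.
Hypothesis quasiM : quasi_uniform M tau.
Implicit Types (t : 'I_(nT M)) (x y p : 'rV[R]_d) (k l : 'I_d.+1).

Local Notation h := (mesh_size M).

Lemma diam_le_mesh_size t : diam t <= h.
Proof. exact: (le_bigmax _ (fun t => diam t)). Qed.

Lemma diam_gt0 t : 0 < diam t.
Proof.
have ut := unitM t.
apply: lt_le_trans (enorm_le_diam (simplex_elt ut ord0) (simplex_elt ut ord_max)).
rewrite lt_neqAle enorm_ge0 andbT; apply/eqP => e0.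
have := dot_le_enorm (dbary t ord0) (vtx (elt t ord0) - vtx (elt t ord_max)).
rewrite -e0 mulr0 -baryB !bary_elt// eqxx -val_eqE /= eq_sym.
by rewrite eqn0Ngt d_gt0 subr0 ler10.
Qed.

Lemma mesh_size_gt0 t : 0 < h.
Proof. exact: lt_le_trans (diam_gt0 t) (diam_le_mesh_size t). Qed.

Lemma enorm_dbary_mesh_size t k : enorm (dbary t k) * h <= `|sigma * tau|.
Proof.
have [r0 gr] := enorm_dbary_inradius k (unitM t) d_gt0.
have hr : h <= `|sigma * tau| * inradius t.
  rewrite (le_trans (quasiM t))// normrM (mulrC `|sigma|) -mulrA.
  rewrite (@le_trans _ _ (`|tau| * diam t))//.
    by rewrite ler_wpM2r ?ler_norm ?(ltW (diam_gt0 t)).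
  rewrite ler_wpM2l// (le_trans (shapeM t))//.
  by rewrite ler_wpM2r ?ler_norm.
rewrite (le_trans (ler_wpM2l (enorm_ge0 _) hr))//.
by rewrite mulrCA ler_piMr.
Qed.

End mesh_sizes.

(** * The bubble function and its gradient *)

Section differentiation.
Context {R : realType} {d : nat}.
Implicit Types (x v g : 'rV[R]_d).

Lemma is_derive_affine g c x v :
  is_derive x v (fun y : 'rV[R]_d => dot g y + c) (dot g v).
Proof.
have dq : (fun s : R => s^-1 *: (((fun y : 'rV[R]_d => dot g y + c) \o shift x) (s *: v)
    - (dot g x + c))) @ 0^' --> dot g v.
  have c0 : (fun=> dot g v) @ (0 : R)^' --> dot g v by exact: cvg_cst.
  apply: cvg_trans c0; apply: near_eq_cvg.
  apply: filterS (nbhs_dnbhs_neq 0) => s s0.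
  by rewrite /= dotDr dotZr /GRing.scale /=; field.
apply: DeriveDef; first exact: (cvgP _ dq).
exact: (cvg_lim _ dq).
Qed.

(** The logarithmic form is available because the factors do not vanish at [x],
    and it makes the induction on the list of factors immediate. *)
Lemma is_derive_prod (I : Type) (r : seq I) (f : I -> 'rV[R]_d -> R) (df : I -> R)
    x v : (forall i, f i x != 0) -> (forall i, is_derive x v (f i) (df i)) ->
  is_derive x v (fun y => \prod_(i <- r) f i y)
    ((\prod_(i <- r) f i x) * \sum_(i <- r) df i / f i x).
Proof.
move=> f0 Hf; elim: r => [|i r IH].
  rewrite !big_nil mulr0 (_ : (fun _ => _) = cst 1); first exact: is_derive_cst.
  by apply/funext => y; rewrite big_nil.
rewrite (_ : (fun _ => _) = f i * (fun y => \prod_(j <- r) f j y)); last first.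
  by apply/funext => y; rewrite big_cons.
apply: is_derive_eq (is_deriveM (Hf i) IH) _.
rewrite !big_cons /GRing.scale /=; field; exact: f0.
Qed.

Lemma partial_near j (f f' : 'rV[R]_d -> R) x a :
  (\forall y \near x, f' y = f y) -> is_derive x (delta_mx 0 j : 'rV[R]_d) f' a ->
  partial j f x = a.
Proof.
move=> ff' [_ <-]; apply: near_eq_derive.
by apply: filterS ff' => y ->.
Qed.

End differentiation.

Section bubble.
Context {R : realType} {d : nat} (M : mesh R d).
Implicit Types (t : 'I_(nT M)) (x y p : 'rV[R]_d) (k l : 'I_d.+1).

(** The polynomial that the bubble equals inside [t], and its gradient. *)
Definition bpoly t x : R := bubble_scale t * \prod_k bary t k x.

Definition bgrad t x : 'rV[R]_d :=
  \sum_k (bubble_scale t * \prod_(l | l != k) bary t l x) *: dbary t k.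

Lemma bgradE t x j : bgrad t x 0 j =
  \sum_k (bubble_scale t * \prod_(l | l != k) bary t l x) * dbary t k 0 j.
Proof. by rewrite /bgrad summxE; apply: eq_bigr => k _; rewrite [LHS]mxE. Qed.

Lemma bary_barycenter t k : bary_mx t \in unitmx ->
  bary t k (barycenter t) = d.+1%:R^-1.
Proof.
move=> ut; rewrite /barycenter scaler_sumr bary_combination; last first.
  by rewrite sumr_const card_ord -[LHS]mulr_natr mulVf// pnatr_eq0.
rewrite (bigD1 k)//= bary_elt// eqxx mulr1 big1 ?addr0// => l lk.
by rewrite bary_elt// eq_sym (negbTE lk) mulr0.
Qed.

Lemma bubble_scaleE t : bary_mx t \in unitmx ->
  bubble_scale t = d.+1%:R ^+ d.+1.
Proof.
move=> ut; rewrite /bubble_scale; under eq_bigr do rewrite bary_barycenter//.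
by rewrite prodr_const card_ord exprVn invrK.
Qed.

Lemma partial_bpoly t x j f : icell t x -> (\forall y \near x, f y = bpoly t y) ->
  partial j f x = bgrad t x 0 j.
Proof.
move=> tx ft; have b0 k : bary t k x != 0 by rewrite gt_eqF// tx.
pose f' y := cst (bubble_scale t) y * \prod_k bary t k y.
apply: (@partial_near _ _ _ _ f').
  by apply: filterS ft => y ->.
have db k : is_derive x (delta_mx 0 j : 'rV[R]_d) (bary t k) (dbary t k 0 j).
  rewrite (_ : bary t k = fun y => dot (dbary t k) y +
    invmx (bary_mx t) (lshift d 0) k).
    by rewrite -dot_delta; exact: is_derive_affine.
  by apply/funext => y; rewrite bary_affine.
have dp := is_derive_prod (index_enum _) b0 db.
apply: is_derive_eq (is_deriveM (is_derive_cst (bubble_scale t) x _) dp) _.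
rewrite bgradE scaler0 addr0 /GRing.scale /= !mulr_sumr.
apply: eq_bigr => k _; rewrite (bigD1 k)//=; field; exact: b0.
Qed.

(** Along the ray from vertex [k], each other barycentric coordinate grows in
    proportion to itself. So the bubble strictly increases along that ray as
    long as [bary t k x] exceeds [1 / (d + 1)], and its gradient cannot be small
    there; this avoids computing the energy integral. *)
Lemma bgrad_radial t k x : bary_mx t \in unitmx ->
  dot (bgrad t x) (x - vtx (elt t k)) =
  bubble_scale t * \prod_(l | l != k) bary t l x * (d.+1%:R * bary t k x - 1).
Proof.
move=> ut; rewrite dotC /bgrad dot_sumr /=.
under eq_bigr => l _ do rewrite dotZr dotC dist_vtx_bary// mulrBr.
rewrite sumrB [X in _ - X](bigD1 k)//= eqxx mulr1 [X in _ - (_ + X)]big1 ?addr0; last first.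
  by move=> l lk; rewrite (negbTE lk) mulr0.
rewrite (eq_bigr (fun=> bubble_scale t * \prod_l bary t l x)); last first.
  by move=> l _; rewrite [in RHS](bigD1 l)//=; ring.
by rewrite sumr_const card_ord (bigD1 k)//= -mulr_natr; ring.
Qed.

Lemma bounded_on_bary t k : bary_mx t \in unitmx ->
  bounded_on (icell t) (bary t k).
Proof.
move=> ut; split.
  rewrite (_ : _ \o _ = fun y : d.-tuple (measurableTypeR R) =>
    \sum_j dbary t k 0 j * tnth y j + invmx (bary_mx t) (lshift d 0) k).
    exact: measurable_affine.
  by apply/funext => y; exact: bary_point_of.
exists 1 => x tx; rewrite ger0_norm ?bary_le1//; first exact: icell_simplex.
exact/ltW/tx.
Qed.

Lemma bounded_on_bpoly t : bary_mx t \in unitmx -> bounded_on (icell t) (bpoly t).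
Proof.
by move=> ut; apply/bounded_onZ/bounded_on_prod => k; exact: bounded_on_bary.
Qed.

Lemma bounded_on_bgrad t j : bary_mx t \in unitmx ->
  bounded_on (icell t) (fun x => bgrad t x 0 j).
Proof.
move=> ut; under eq_fun do rewrite bgradE.
apply: bounded_on_sum => k; apply: bounded_onM; last exact: bounded_on_cst.
by apply/bounded_onZ/bounded_on_prod => l; exact: bounded_on_bary.
Qed.

End bubble.

(** * Scaling of the mass and energy of a bubble *)

Section bubble_scaling.
Context {R : realType} {d : nat} (M : mesh R d) (K : R).
Hypothesis d_gt0 : (0 < d)%N.
Hypothesis unitM : forall t : 'I_(nT M), bary_mx t \in unitmx.
Hypothesis K_gt0 : 0 < K.
Hypothesis gradK : forall (t : 'I_(nT M)) k,
  enorm (dbary t k) * mesh_size M <= K.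
Implicit Types (t : 'I_(nT M)) (x p : 'rV[R]_d) (k : 'I_d.+1).

Local Notation h := (mesh_size M).
Local Notation n1 := (d.+1%:R : R).
Let alpha : R := n1 ^+ d.+1.
Let eps : R := (4 * n1)^-1.
Let rho : R := eps * h / (d%:R * K).
(* The volume of the box of radius [rho] relative to that of radius [h]. *)
Let kappa : R := (eps / (d%:R * K)) ^+ d.

Let n1_gt0 : 0 < n1. Proof. by rewrite ltr0n. Qed.
Let d_gt0R : 0 < d%:R :> R. Proof. by rewrite ltr0n. Qed.
Let alpha_gt0 : 0 < alpha. Proof. by rewrite exprn_gt0. Qed.
Let eps_gt0 : 0 < eps. Proof. by rewrite invr_gt0 mulr_gt0. Qed.
Let kappa_gt0 : 0 < kappa.
Proof. by rewrite exprn_gt0// divr_gt0// mulr_gt0. Qed.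

(** The radius [rho] is chosen so that, under the gradient bound [K / h], no
    barycentric coordinate moves by more than [eps] on the box. *)
Lemma bary_box t k p x : box p rho x -> bary t k p - eps <= bary t k x.
Proof.
move=> px; have h0 := mesh_size_gt0 d_gt0 unitM t.
rewrite lerBlDr -lerBlDl baryB (le_trans (ler_norm _))//.
rewrite (le_trans (ler_norm_sum _ _ _))//.
rewrite (@le_trans _ _ (\sum_(i < d) (eps / d%:R)))//; last first.
  by rewrite sumr_const card_ord -[leLHS]mulr_natr divfK// gt_eqF.
apply: ler_sum => i _; rewrite normrM.
rewrite (@le_trans _ _ (K / h * rho))//; last first.
  rewrite le_eqVlt; apply/orP; left; apply/eqP; rewrite /rho; field.
  by rewrite !gt_eqF.
apply: ler_pM => //; last by rewrite !mxE distrC; exact: px.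
by rewrite ler_pdivlMr// (le_trans _ (gradK t k))//
  ler_wpM2r ?coord_le_enorm// ltW.
Qed.

(* Midway between a vertex and the barycenter, every barycentric coordinate is
   at least [2 * eps], and that of the vertex exceeds [1 / (d + 1)]. *)
Let p t : 'rV[R]_d := 2^-1 *: (vtx (elt t ord0) + barycenter t).

Let bary_p t k : bary t k (p t) = ((k == ord0)%:R + n1^-1) / 2.
Proof.
rewrite -(bary_elt (unitM t)) -(bary_barycenter k (unitM t)) !bary_affine.
by rewrite dotZr dotDr; field.
Qed.

Lemma box_bary t x : box (p t) rho x ->
  (forall k, eps <= bary t k x) /\ 4^-1 <= n1 * bary t ord0 x - 1.
Proof.
move=> bx.
have epsE : n1^-1 / 2 = eps + eps by rewrite /eps; field; rewrite gt_eqF.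
split=> [k|].
  have := bary_box t k bx; rewrite bary_p mulrDl epsE.
  by have : 0 <= (k == ord0)%:R :> R by []; lra.
have := bary_box t ord0 bx; rewrite bary_p eqxx mulrDl epsE => bx0.
have n2 : 2 <= n1 by rewrite ler_nat.
have n1e : n1 * eps = 4^-1 by rewrite /eps; field; rewrite gt_eqF.
have : n1 * (1%:R / 2 + (eps + eps) - eps) <= n1 * bary t ord0 x.
  by rewrite ler_pM2l.
by rewrite [leLHS](_ : _ = n1 / 2 + n1 * eps); [rewrite n1e; lra|field].
Qed.

(** The box has side proportional to [h], and the simplex fits in a box of
    radius [h]. Comparing volumes of boxes replaces any change of variables to
    a reference simplex. *)
Lemma icell_volume t :
  [/\ region (icell t), region (box (p t) rho), box (p t) rho `<=` icell t,
      0 < vol (icell t) & kappa * vol (icell t) <= vol (box (p t) rho)].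
Proof.
have h0 := mesh_size_gt0 d_gt0 unitM t.
have rho_gt0 : 0 < rho by rewrite divr_gt0 ?mulr_gt0.
have [rB vB] := box_vol (p t) (ltW rho_gt0).
have [rH vH] := box_vol (vtx (elt t ord0)) (ltW h0).
have BT : box (p t) rho `<=` icell t.
  by move=> x /box_bary[+ _] k => /(_ k); exact: lt_le_trans.
have TH : icell t `<=` box (vtx (elt t ord0)) h.
  move=> x tx i; apply: le_trans (diam_le_mesh_size t).
  have ut := unitM t.
  have := enorm_le_diam (icell_simplex ut tx) (simplex_elt ut ord0).
  by apply: le_trans; have := coord_le_enorm (x - vtx (elt t ord0)) i; rewrite !mxE.
have [rT vT] := le_vol rH (measurable_icell t) TH.
have [_ vBT] := le_vol rT rB.1 BT.
have vB_gt0 : 0 < vol (box (p t) rho) by rewrite vB exprn_gt0// mulrn_wgt0.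
split => //; first exact: lt_le_trans vBT.
rewrite (le_trans (ler_wpM2l (ltW kappa_gt0) vT))// vB vH -exprMn.
rewrite le_eqVlt; apply/orP; left; apply/eqP; congr (_ ^+ _).
by rewrite /rho; field; rewrite !gt_eqF.
Qed.

Definition bubble_mass t := integral_Rn (icell t) (bpoly t).

Definition bubble_energy t :=
  integral_Rn (icell t) (fun x => dot (bgrad t x) (bgrad t x)).

Lemma bounded_on_bgrad_sqr t :
  bounded_on (icell t) (fun x => dot (bgrad t x) (bgrad t x)).
Proof.
by apply: bounded_on_sum => i; apply: bounded_onM; exact: bounded_on_bgrad.
Qed.

Lemma prod_bary01 t x (P : pred 'I_d.+1) : icell t x ->
  0 <= \prod_(k | P k) bary t k x <= 1.
Proof.
move=> tx; rewrite prodr_ge0 => [|k _]; last exact/ltW/tx.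
rewrite -[leRHS](@big1 _ _ *%R _ (index_enum _) P (fun=> 1))//.
apply: ler_prod => k _; by rewrite ltW ?tx//= bary_le1//; exact: icell_simplex.
Qed.

(** The barycentric coordinates are at most 1 on the simplex, and at least [eps]
    on the box. *)
Lemma bubble_mass_bounds t :
  alpha * eps ^+ d.+1 * kappa * vol (icell t) <= bubble_mass t
    <= alpha * vol (icell t).
Proof.
have ut := unitM t; have [rT rB BT vT vB] := icell_volume t.
have bp : forall x, icell t x -> 0 <= bpoly t x <= alpha.
  move=> x tx; rewrite /bpoly bubble_scaleE// -/alpha.
  have /andP[p0 p1] := prod_bary01 xpredT tx.
  by rewrite mulr_ge0 ?(ltW alpha_gt0)//= ler_piMr// ltW.
apply/andP; split; last first.
  rewrite -integral_Rn_cst//; apply: le_integral_Rn => //.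
  - exact: bounded_on_bpoly.
  - exact: bounded_on_cst.
  - by move=> x /bp/andP[].
apply: (@le_trans _ _ (alpha * eps ^+ d.+1 * vol (box (p t) rho))).
  by rewrite -mulrA ler_pM2l// mulr_gt0// exprn_gt0.
apply: integral_Rn_ge => //; first exact: bounded_on_bpoly.
  by move=> x /bp/andP[].
move=> x /box_bary[bx _]; rewrite /bpoly bubble_scaleE// -/alpha ler_pM2l//.
rewrite -[X in _ ^+ X]card_ord -prodr_const; apply: ler_prod => k _.
by rewrite bx (ltW eps_gt0).
Qed.

(** Inverse estimate and its converse: above, the bubble is a polynomial in
    barycentric coordinates, whose gradients are at most [K / h]; below, the
    radial derivative on the box is at least a constant while the distance to
    the vertex is at most [h]. *)
Lemma bubble_energy_bounds t :
  (alpha * eps ^+ d / 4) ^+ 2 * kappa * vol (icell t)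
    <= h ^+ 2 * bubble_energy t
    <= d%:R * (alpha * n1 * K) ^+ 2 * vol (icell t).
Proof.
have ut := unitM t; have [rT rB BT vT vB] := icell_volume t.
have h0 := mesh_size_gt0 d_gt0 unitM t.
have bq := bounded_on_bgrad_sqr t.
rewrite /bubble_energy -integral_RnZ//; apply/andP; split.
  apply: (@le_trans _ _ ((alpha * eps ^+ d / 4) ^+ 2 * vol (box (p t) rho))).
    by rewrite -mulrA ler_wpM2l// sqr_ge0.
  apply: integral_Rn_ge => //.
  - exact: bounded_onZ.
  - by move=> x _; rewrite mulr_ge0 ?sqr_ge0 ?dot_ge0.
  move=> x Bx; have [bx b0] := box_bary Bx.
  set v := x - vtx (elt t ord0).
  have hv : dot v v <= h ^+ 2.
    rewrite -sqr_enorm ler_sqr ?nnegrE ?enorm_ge0 ?(ltW h0)//.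
    apply: le_trans (diam_le_mesh_size t).
    by apply: enorm_le_diam; [exact/(icell_simplex ut)/BT|exact: simplex_elt].
  have rad : alpha * eps ^+ d / 4 <= dot (bgrad t x) v.
    rewrite bgrad_radial// bubble_scaleE// -/alpha.
    apply: ler_pM => //; first by rewrite mulr_ge0 ?exprn_ge0// ltW.
    rewrite ler_pM2l//.
    have -> : eps ^+ d = \prod_(k | k != ord0 :> 'I_d.+1) eps.
      by rewrite prodr_const cardC1 card_ord.
    by apply: ler_prod => k _; rewrite bx (ltW eps_gt0).
  have rad0 : 0 <= alpha * eps ^+ d / 4.
    by rewrite divr_ge0// mulr_ge0 ?exprn_ge0// ltW.
  apply: (@le_trans _ _ (dot (bgrad t x) v ^+ 2)).
    by rewrite ler_sqr ?nnegrE// (le_trans rad0).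
  rewrite (le_trans (dot_CauchySchwarz _ _))// mulrC.
  by rewrite ler_wpM2r ?dot_ge0.
rewrite -integral_Rn_cst//; apply: le_integral_Rn => //.
- exact: bounded_onZ.
- exact: bounded_on_cst.
move=> x tx; rewrite /dot mulr_sumr.
apply: (@le_trans _ _ (\sum_(i < d) (alpha * n1 * K) ^+ 2)); last first.
  by rewrite sumr_const card_ord -[leLHS]mulr_natl.
apply: ler_sum => i _; rewrite -expr2 -exprMn.
rewrite -real_normK ?num_real// ler_sqr ?nnegrE//; last first.
  by rewrite !mulr_ge0// ltW.
rewrite normrM bgradE (ger0_norm (ltW h0)).
apply: (@le_trans _ _ (h * \sum_k alpha * enorm (dbary t k))).
  rewrite ler_pM2l// (le_trans (ler_norm_sum _ _ _))//; apply: ler_sum => k _.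
  rewrite bubble_scaleE// -/alpha !normrM (ger0_norm (ltW alpha_gt0)) -mulrA.
  rewrite ler_pM2l// -[leRHS]mul1r; apply: ler_pM => //; last exact: coord_le_enorm.
  by have /andP[p0 p1] := prod_bary01 (fun l => l != k) tx; rewrite ger0_norm.
rewrite mulr_sumr (@le_trans _ _ (\sum_(k < d.+1) alpha * K))//.
  apply: ler_sum => k _; rewrite mulrCA ler_pM2l// mulrC; exact: gradK.
by rewrite sumr_const card_ord -[leLHS]mulr_natl mulrCA mulrA.
Qed.

Definition ratio_lower : R :=
  (alpha * eps ^+ d.+1 * kappa) ^+ 2 / (d%:R * (alpha * n1 * K) ^+ 2).

Definition ratio_upper : R := alpha ^+ 2 / ((alpha * eps ^+ d / 4) ^+ 2 * kappa).

Lemma ratio_lower_gt0 : 0 < ratio_lower.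
Proof.
rewrite divr_gt0//; last by rewrite mulr_gt0// exprn_gt0// !mulr_gt0.
by rewrite exprn_gt0// mulr_gt0// mulr_gt0// exprn_gt0.
Qed.

Lemma ratio_upper_gt0 : 0 < ratio_upper.
Proof.
rewrite divr_gt0 ?exprn_gt0// mulr_gt0// exprn_gt0// divr_gt0//.
by rewrite mulr_gt0// exprn_gt0.
Qed.

Lemma bubble_energy_gt0 t : 0 < bubble_energy t.
Proof.
have h0 := mesh_size_gt0 d_gt0 unitM t; have [_ _ _ vT _] := icell_volume t.
have /andP[+ _] := bubble_energy_bounds t => lo.
rewrite -(@pmulr_rgt0 _ (h ^+ 2)) ?exprn_gt0//; apply: lt_le_trans lo.
by rewrite mulr_gt0// mulr_gt0// exprn_gt0// divr_gt0// mulr_gt0// exprn_gt0.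
Qed.

(** The heart of the scaling argument: the Schur complement sees the bubble of
    [t] only through this quotient, which behaves like [h ^+ 2] times the
    volume. *)
Lemma bubble_ratio t :
  ratio_lower * h ^+ 2 * vol (icell t) <= bubble_mass t ^+ 2 / bubble_energy t
    <= ratio_upper * h ^+ 2 * vol (icell t).
Proof.
have h0 := mesh_size_gt0 d_gt0 unitM t; have [_ _ _ vT _] := icell_volume t.
have e0 := bubble_energy_gt0 t.
have /andP[m1 m2] := bubble_mass_bounds t.
have /andP[e1 e2] := bubble_energy_bounds t.
have c0 : 0 < alpha * eps ^+ d.+1 * kappa by rewrite !mulr_gt0// exprn_gt0.
have m0 : 0 <= bubble_mass t by apply: le_trans m1; rewrite mulr_ge0// ltW.
have C0 : 0 < d%:R * (alpha * n1 * K) ^+ 2.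
  by rewrite mulr_gt0// exprn_gt0// !mulr_gt0.
have C1 : 0 < (alpha * eps ^+ d / 4) ^+ 2 * kappa.
  by rewrite mulr_gt0// exprn_gt0// divr_gt0// mulr_gt0// exprn_gt0.
have sq a b : 0 <= a -> a <= b -> a ^+ 2 <= b ^+ 2 :> R.
  by move=> a0 ab; rewrite ler_sqr ?nnegrE// (le_trans a0).
rewrite ler_pdivlMr// ler_pdivrMr//; apply/andP; split.
  apply: le_trans (sq _ _ _ m1); last by rewrite mulr_ge0// ltW.
  rewrite /ratio_lower.
  set c := alpha * eps ^+ d.+1 * kappa; set C := d%:R * _.
  rewrite [leLHS](_ : _ = c ^+ 2 / C * vol (icell t) * (h ^+ 2 * bubble_energy t));
    last by ring.
  rewrite (le_trans (ler_wpM2l _ e2))//.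
    by rewrite mulr_ge0 ?(ltW vT)// divr_ge0 ?sqr_ge0// ltW.
  by rewrite -/C le_eqVlt; apply/orP; left; apply/eqP; field; rewrite gt_eqF.
apply: le_trans (sq _ _ m0 m2) _.
rewrite /ratio_upper; set C := _ * kappa.
rewrite [leRHS](_ : _ = alpha ^+ 2 / C * vol (icell t) * (h ^+ 2 * bubble_energy t));
  last by ring.
rewrite (le_trans _ (ler_wpM2l _ e1))//.
  by rewrite -/C le_eqVlt; apply/orP; left; apply/eqP; field; rewrite gt_eqF.
by rewrite mulr_ge0 ?(ltW vT)// divr_ge0 ?sqr_ge0// ltW.
Qed.

End bubble_scaling.

Arguments ratio_lower {R} d K.
Arguments ratio_upper {R} d K.

(** * Decomposition of the domain into simplices *)

Section mesh_on_domain.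
Context {R : realType} {d : nat} (Omega : set 'rV[R]_d) (M : mesh R d).
Hypothesis d_gt0 : (0 < d)%N.
Hypothesis regular_Omega : (closure Omega)° = Omega.
Hypothesis triM : triangulation M Omega.
Implicit Types (t : 'I_(nT M)) (x : 'rV[R]_d) (b : bubble_index M).

Lemma unit_bary_mx t : bary_mx t \in unitmx.
Proof. by case: triM. Qed.

(** The interior of a simplex is an open subset of [closure Omega], hence a
    subset of the interior of that closure. *)
Lemma icell_sub_Omega t : icell t `<=` Omega.
Proof.
move=> x tx; rewrite -regular_Omega; apply: filterS (icell_near tx) => y ty.
case: triM => _ _ _ _ ->; exists t => //.
exact: icell_simplex (unit_bary_mx t) _ ty.
Qed.

(** Distinct simplices meet in the hull of their common vertices, which lies in
    a face of the first one, since two cells of the same cardinality cannot be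
    strictly nested. *)
Lemma icell_notin_simplex t t' x : t != t' -> icell t x -> ~ simplex t' x.
Proof.
move=> tt' tx t'x; case: triM => _ ut cell_inj tri _.
have xI : (simplex t `&` simplex t') x by split=> //; exact: icell_simplex.
rewrite tri in xI.
have [k kt'] : exists k, elt t k \notin cell t'.
  apply: contrapT => H; move/eqP: tt'; apply; apply: cell_inj.
  apply/eqP; rewrite eqEcard !card_imset; try exact: elt_inj.
  rewrite leqnn andbT; apply/fintype.subsetP => i /imsetP[k _ ->].
  by apply: contrapT => /negP kt'; apply: H; exists k.
have [_ b0] := hull_bary (ut t) k (subsetIl _ _) xI.
have := tx k; rewrite b0 ?ltxx//.
by rewrite inE negb_and kt' orbT.
Qed.

Lemma icell_disjoint t t' x : icell t x -> icell t' x -> t = t'.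
Proof.
move=> tx t'x; apply/eqP; apply: contrapT => /negP tt'.
exact: (icell_notin_simplex tt' tx (icell_simplex (unit_bary_mx t') t'x)).
Qed.

Definition face t (k : 'I_d.+1) : set 'rV[R]_d := [set x | bary t k x = 0].

(** For [d > 0] a barycentric coordinate differs at two vertices, so its zero
    set is a genuine hyperplane. *)
Lemma face_null t k : measurable (coords (face t k)) /\
  lebesgue_Rn d (coords (face t k)) = 0%E.
Proof.
have faceE : coords (face t k) = [set y | \sum_j dbary t k 0 j * tnth y j +
    invmx (bary_mx t) (lshift d 0) k = 0].
  apply/seteqP; split=> y; by rewrite /coords /face /= bary_point_of.
split.
  rewrite faceE -[X in measurable X]setTI.
  by apply: (@measurable_affine R _ _ _ measurableT [set 0]); exact: measurable_set1.
have [j gj] : exists j, dbary t k 0 j != 0.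
  apply/rV0Pn; apply/eqP => g0.
  have [l kl] : exists l, k != l.
    case: (eqVneq k ord0) => [->|k0]; last by exists ord0.
    by exists ord_max; rewrite -val_eqE /= eq_sym -lt0n.
  have ut := unit_bary_mx t.
  have := dist_vtx_bary ut k l (vtx (elt t k)).
  rewrite g0 dotC dot0r bary_elt// eqxx (negbTE kl) subr0 => /esym/eqP.
  by rewrite oner_eq0.
by rewrite faceE; exact: hyperplane_null gj.
Qed.

(** Every point of the domain off the faces is in the interior of some simplex,
    so the values of [f] on the faces do not matter. *)
Lemma integral_Omega f (F : 'I_(nT M) -> 'rV[R]_d -> R) :
  (forall t, bounded_on (icell t) (F t)) ->
  (forall t x, icell t x -> f x = F t x) ->
  integral_Rn Omega f = \sum_t integral_Rn (icell t) (F t).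
Proof.
move=> bF fF.
pose N := \big[setU/set0]_(q : 'I_(nT M) * 'I_d.+1) coords (face q.1 q.2).
have [mN N0] : measurable N /\ lebesgue_Rn d N = 0%E.
  rewrite /N; elim/big_ind: _ => [|A B [mA A0] [mB B0]|q _]; last exact: face_null.
    by rewrite measure0.
  by split; [exact: measurableU|exact: null_set_setU].
have faceN t k y : face t k (point_of y) -> N y.
  move=> fy; rewrite /N -bigcup_seq; exists (t, k) => //=.
  by rewrite mem_index_enum.
apply: (integral_Rn_pieces mN N0) => //.
- by move=> t; exact/icell_region/unit_bary_mx.
- exact: icell_sub_Omega.
- exact: icell_disjoint.
move=> y Ny /subset_closure; case: triM => _ _ _ _ -> [t _ ty].
exists t => k; rewrite lt_neqAle ((simplexP (unit_bary_mx t) _).1 ty) andbT eq_sym.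
by apply/negP => /eqP b0; apply: Ny; exact: faceN b0.
Qed.

End mesh_on_domain.

(** * Stiffness matrix of the bubbles *)

Section strain_algebra.
Context {R : realType} {d : nat}.
Implicit Types (u v w q : 'rV[R]_d).

(** The strain of a fixed vector [v] times a scalar function of gradient [q]. *)
Definition sym_outer v q : 'M[R]_d :=
  \matrix_(i, j) (2^-1 * (v 0 i * q 0 j + v 0 j * q 0 i)).

Lemma dot_mul2 (a b c e : 'I_d -> R) :
  \sum_i \sum_j (a i * b i) * (c j * e j) =
  (\sum_i a i * b i) * (\sum_j c j * e j).
Proof. by rewrite mulr_suml; apply: eq_bigr => i _; rewrite mulr_sumr. Qed.

Lemma ddot_sym_outer v w q : ddot (sym_outer v q) (sym_outer w q) =
  2^-1 * (dot v w * dot q q + dot v q * dot w q).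
Proof.
have e1 := dot_mul2 (v 0) (w 0) (q 0) (q 0).
have e2 := dot_mul2 (v 0) (q 0) (w 0) (q 0).
have e3 := dot_mul2 (w 0) (q 0) (v 0) (q 0).
have e4 := dot_mul2 (q 0) (q 0) (v 0) (w 0).
transitivity (4^-1 * (dot v w * dot q q + dot v q * dot w q +
    dot w q * dot v q + dot q q * dot v w)); last by field.
rewrite /dot -e1 -e2 -e3 -e4 -!big_split /= mulr_sumr.
apply: eq_bigr => i _; rewrite -!big_split /= mulr_sumr.
by apply: eq_bigr => j _; rewrite !mxE; field.
Qed.

End strain_algebra.

Section element_matrices.
Context {R : realType} {d : nat} (Omega : set 'rV[R]_d) (M : mesh R d).
Hypothesis d_gt0 : (0 < d)%N.
Hypothesis regular_Omega : (closure Omega)° = Omega.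
Hypothesis triM : triangulation M Omega.
Implicit Types (t : 'I_(nT M)) (x : 'rV[R]_d) (b : bubble_index M).

Let unitM t : bary_mx t \in unitmx := unit_bary_mx triM t.
Let tiles := integral_Omega d_gt0 regular_Omega triM.

Lemma bubble_icell t t' x : icell t x ->
  bubble t' x = (t' == t)%:R * bpoly t x.
Proof.
move=> tx; rewrite /bubble indicE; have [->|t't] := eqVneq t' t.
  by rewrite mem_set//; exact: (icell_simplex (unitM t)).
rewrite memNset ?mul0r//; apply: (icell_notin_simplex triM _ tx).
by rewrite eq_sym.
Qed.

(** Near a point of [icell t] the bubble of [t] is a polynomial and the other
    bubbles are zero. *)
Lemma vgrad_vbubble b t x : icell t x ->
  vgrad (vbubble b) x =
  \matrix_(i, j) ((b.1 == t)%:R *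
    ((delta_mx 0 b.2 : 'rV[R]_d) 0 i * bgrad t x 0 j)).
Proof.
move=> tx; apply/matrixP => i j; rewrite !mxE eqxx /=.
have -> : (fun y => vbubble b y 0 i) = (fun y => bubble b.1 y * (i == b.2)%:R).
  by apply/funext => y; rewrite !mxE eqxx.
have near0 (f : 'rV[R]_d -> R) : (\forall y \near x, f y = 0) -> partial j f x = 0.
  move=> f0; apply: (@partial_near _ _ _ _ (cst 0)).
  by apply: filterS f0 => y ->.
have near_t := icell_near tx.
have [ib|ib] := eqVneq i b.2; last first.
  by rewrite mul0r mulr0 near0//; apply: filterS near_t => y _; rewrite mulr0.
have [bt|bt] := eqVneq b.1 t; last first.
  rewrite mul0r near0//; apply: filterS near_t => y ty.
  by rewrite (bubble_icell _ ty) (negbTE bt) !mul0r.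
rewrite !mul1r; apply: partial_bpoly => //; apply: filterS near_t => y ty.
by rewrite (bubble_icell _ ty) bt eqxx mul1r mulr1.
Qed.

Lemma strain_vbubble b t x : icell t x ->
  strain (vbubble b) x = (b.1 == t)%:R *: sym_outer (delta_mx 0 b.2) (bgrad t x).
Proof.
move=> tx; rewrite /strain (vgrad_vbubble _ tx); apply/matrixP => i j.
rewrite [LHS]mxE [in LHS]mxE [X in _ * (X + _)]mxE [X in _ * (_ + X)]mxE.
by rewrite [X in _ * (_ + X)]mxE [RHS]mxE [X in _ = _ * X]mxE; ring.
Qed.

Lemma div_vbubble b t x : icell t x ->
  div (vbubble b) x = (b.1 == t)%:R * bgrad t x 0 b.2.
Proof.
move=> tx; rewrite /div (vgrad_vbubble _ tx) /mxtrace.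
rewrite -(dot_deltal _ b.2) /dot mulr_sumr.
by apply: eq_bigr => i _; rewrite [LHS]mxE.
Qed.

Definition energy_mx t : 'M[R]_d :=
  \matrix_(i, j) integral_Rn (icell t) (fun x => bgrad t x 0 i * bgrad t x 0 j).

(** The diagonal block of the stiffness matrix of the bubbles on [t]. *)
Definition elastic_block (lambda mu : R) t : 'M[R]_d :=
  (mu * bubble_energy t)%:M + (mu + lambda) *: energy_mx t.

Lemma elastic_blockE lambda mu t i j : elastic_block lambda mu t i j =
  mu * bubble_energy t * (i == j)%:R + (mu + lambda) * energy_mx t i j.
Proof.
by rewrite [LHS]mxE; congr (_ + _); rewrite [LHS]mxE// mulr_natr.
Qed.

Let bounded_grad2 t i j :
  bounded_on (icell t) (fun x => bgrad t x 0 i * bgrad t x 0 j).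
Proof. by apply: bounded_onM; exact: bounded_on_bgrad. Qed.

(** A bubble vanishes on the cells of the other bubbles, so [A_b] is block
    diagonal; inside a block, [ddot_sym_outer] turns the strain energy of a
    pair of bubbles into products of partial derivatives. *)
Lemma A_bE lambda mu k l : A_b Omega M lambda mu k l =
  ((enum_val k).1 == (enum_val l).1)%:R *
    elastic_block lambda mu (enum_val k).1 (enum_val k).2 (enum_val l).2.
Proof.
rewrite mxE /elasticity.
move: (enum_val l) (enum_val k) => [s a] [s' a'] /=.
pose same t : R := (s == t)%:R * (s' == t)%:R.
have brd t : bounded_on (icell t) (fun x =>
    (a == a')%:R * dot (bgrad t x) (bgrad t x) + bgrad t x 0 a * bgrad t x 0 a').
  by apply: bounded_onD => //; apply: bounded_onZ; exact: bounded_on_bgrad_sqr.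
rewrite (tiles (F := fun t x => same t * (2^-1 * ((a == a')%:R *
    dot (bgrad t x) (bgrad t x) + bgrad t x 0 a * bgrad t x 0 a')))).
- rewrite (tiles (F := fun t x => same t * (bgrad t x 0 a * bgrad t x 0 a'))).
  + have sumE (F : 'I_(nT M) -> R) : \sum_t same t * F t = (s' == s)%:R * F s'.
      rewrite (bigD1 s')//= big1 ?addr0; last first.
        by move=> t ts'; rewrite /same [s' == t]eq_sym (negbTE ts') mulr0 mul0r.
      by rewrite /same eqxx mulr1 eq_sym.
    rewrite (eq_bigr (fun t => same t * (2^-1 * ((a == a')%:R * bubble_energy t +
        energy_mx t a a')))) => [|t _]; last first.
      rewrite integral_RnZ//; [|exact: icell_region|exact: bounded_onZ].
      rewrite integral_RnZ//; [|exact: icell_region].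
      rewrite integral_RnD//; [|exact: icell_region|]; last first.
        by apply: bounded_onZ; exact: bounded_on_bgrad_sqr.
      rewrite integral_RnZ//; [|exact: icell_region|exact: bounded_on_bgrad_sqr].
      by rewrite [energy_mx _ _ _]mxE.
    rewrite [X in lambda * X](eq_bigr (fun t => same t * energy_mx t a a')); last first.
      move=> t _; rewrite integral_RnZ//; last exact: icell_region.
      by rewrite [energy_mx _ _ _]mxE.
    rewrite !sumE elastic_blockE.
    have -> : energy_mx s' a' a = energy_mx s' a a'.
      by rewrite !mxE; apply: eq_integral_Rn => x _; rewrite mulrC.
    by rewrite [a' == a]eq_sym; field.
  + by move=> t; apply: bounded_onZ.
  + move=> t x tx; rewrite !(div_vbubble _ tx) /same /=; ring.
- by move=> t; apply: bounded_onZ; exact: bounded_onZ.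
move=> t x tx; rewrite !(strain_vbubble _ tx) /=.
have -> (c e : R) (A B : 'M[R]_d) : ddot (c *: A) (e *: B) = c * e * ddot A B.
  rewrite /ddot mulr_sumr; apply: eq_bigr => i _; rewrite mulr_sumr.
  by apply: eq_bigr => j _; rewrite !mxE; ring.
rewrite ddot_sym_outer !dot_deltal; congr (_ * (_ * (_ * _ + _))).
by rewrite mxE eqxx.
Qed.

Lemma sum_bubble_index (F : bubble_index M -> R) :
  \sum_(k < #|{: bubble_index M}|) F (enum_val k) = \sum_t \sum_j F (t, j).
Proof.
by rewrite -big_enum_val pair_bigA; apply: eq_big => [] // [].
Qed.

(** The bubble coefficients on [t] form a constant vector: the displacement on
    [t] is this vector times the scalar bubble. *)
Definition cell_part (w : 'cV[R]_#|{: bubble_index M}|) t : 'rV[R]_d :=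
  \row_j w (enum_rank ((t, j) : bubble_index M)) 0.

Lemma sum_cell_part (w : 'cV[R]_#|{: bubble_index M}|)
    (F : bubble_index M -> R -> R) :
  \sum_k F (enum_val k) (w k 0) = \sum_t \sum_j F (t, j) (cell_part w t 0 j).
Proof.
transitivity (\sum_(k < #|{: bubble_index M}|)
    F (enum_val k) (w (enum_rank (enum_val k)) 0)).
  by apply: eq_bigr => k _; rewrite enum_valK.
rewrite (sum_bubble_index (fun b => F b (w (enum_rank b) 0))).
by apply: eq_bigr => t _; apply: eq_bigr => j _; rewrite mxE.
Qed.

Lemma block_energy (lambda mu : R) t (v : 'rV[R]_d) :
  \sum_i \sum_j v 0 i * v 0 j * elastic_block lambda mu t i j =
  mu * (bubble_energy t * dot v v) +
  (mu + lambda) * integral_Rn (icell t) (fun x => dot v (bgrad t x) ^+ 2).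
Proof.
have rT := icell_region (unitM t).
have -> : integral_Rn (icell t) (fun x => dot v (bgrad t x) ^+ 2) =
    \sum_i \sum_j v 0 i * v 0 j * energy_mx t i j.
  rewrite (@eq_integral_Rn _ _ _ _ (fun x => \sum_i \sum_j
      v 0 i * v 0 j * (bgrad t x 0 i * bgrad t x 0 j))).
    rewrite integral_Rn_sum//; last first.
      by move=> i; apply: bounded_on_sum => j; exact: bounded_onZ.
    apply: eq_bigr => i _; rewrite integral_Rn_sum//; last first.
      by move=> j; exact: bounded_onZ.
    by apply: eq_bigr => j _; rewrite integral_RnZ// [energy_mx _ _ _]mxE.
  move=> x _; rewrite expr2 {1}/dot mulr_suml; apply: eq_bigr => i _.
  by rewrite /dot mulr_sumr; apply: eq_bigr => j _; ring.
rewrite /dot !mulr_sumr -big_split /=; apply: eq_bigr => i _.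
rewrite mulr_sumr (bigD1 i)//= [X in _ = _ + X](bigD1 i)//= addrA; congr (_ + _).
  by rewrite elastic_blockE eqxx mulr1n; ring.
apply: eq_bigr => j ji.
by rewrite elastic_blockE eq_sym (negbTE ji) mulr0n; ring.
Qed.

Lemma A_b_qform lambda mu (w : 'cV[R]_#|{: bubble_index M}|) :
  qform (A_b Omega M lambda mu) w =
  \sum_t (mu * (bubble_energy t * dot (cell_part w t) (cell_part w t)) +
    (mu + lambda) *
      integral_Rn (icell t) (fun x => dot (cell_part w t) (bgrad t x) ^+ 2)).
Proof.
rewrite qformE; pose W b := w (enum_rank b) 0.
transitivity (\sum_t \sum_i \sum_t' \sum_j W (t, i) * W (t', j) *
    ((t == t')%:R * elastic_block lambda mu t i j)).
  rewrite -(sum_bubble_index (fun b => \sum_t' \sum_j W b * W (t', j) *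
    ((b.1 == t')%:R * elastic_block lambda mu b.1 b.2 j))).
  apply: eq_bigr => k _.
  rewrite -(sum_bubble_index (fun b' => W (enum_val k) * W b' *
    (((enum_val k).1 == b'.1)%:R *
      elastic_block lambda mu (enum_val k).1 (enum_val k).2 b'.2))).
  by apply: eq_bigr => l _; rewrite A_bE /W !enum_valK.
apply: eq_bigr => t _; rewrite -block_energy; apply: eq_bigr => i _.
rewrite (bigD1 t)//= [X in _ + X]big1 ?addr0; last first.
  move=> t' t't; apply: big1 => j _.
  by rewrite eq_sym (negbTE t't) mul0r mulr0.
by apply: eq_bigr => j _; rewrite eqxx mul1r !mxE.
Qed.

End element_matrices.

(** * Schur complement and Laplace matrix *)

Section affine_pressures.
Context {R : realType} {d : nat} (Omega : set 'rV[R]_d) (M : mesh R d)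
  (phi : 'I_(nV M) -> 'rV[R]_d -> R).
Hypothesis d_gt0 : (0 < d)%N.
Hypothesis regular_Omega : (closure Omega)° = Omega.
Hypothesis triM : triangulation M Omega.
Hypothesis affine_phi : forall i (t : 'I_(nT M)), affine_on (simplex t) (phi i).
Implicit Types (t : 'I_(nT M)) (z : 'cV[R]_(nV M)).

Let unitM t : bary_mx t \in unitmx := unit_bary_mx triM t.
Let tiles := integral_Omega d_gt0 regular_Omega triM.

Definition cell_grad i t : 'rV[R]_d := projT1 (cid (affine_phi i t)).

Lemma grad_phi i t x : icell t x -> grad (phi i) x = cell_grad i t.
Proof.
rewrite /cell_grad; case: cid => g [c phiE] /= tx; apply/rowP => j; rewrite mxE.
rewrite -dot_delta; apply: (@partial_near _ _ _ _ (fun y => dot g y + c)).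
  apply: filterS (icell_near tx) => y ty; rewrite phiE//.
  exact: icell_simplex (unitM t) _ ty.
exact: is_derive_affine.
Qed.

(** The gradient on [t] of the pressure with nodal values [z]. *)
Definition pressure_grad z t : 'rV[R]_d := \sum_i z i 0 *: cell_grad i t.

Lemma stiffness_qform z : qform (stiffness Omega phi) z =
  \sum_t vol (icell t) * dot (pressure_grad z t) (pressure_grad z t).
Proof.
have LE i j : stiffness Omega phi i j =
    \sum_t vol (icell t) * dot (cell_grad j t) (cell_grad i t).
  rewrite mxE (tiles (F := fun t _ => dot (cell_grad j t) (cell_grad i t))).
  - apply: eq_bigr => t _; rewrite integral_Rn_cst 1?mulrC//.
    exact/icell_region/unitM.
  - by move=> t; exact: bounded_on_cst.
  - by move=> t x tx; rewrite !(grad_phi _ tx).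
rewrite qformE.
under eq_bigr => i _ do under eq_bigr => j _ do rewrite LE mulr_sumr.
under eq_bigr => i _ do rewrite exchange_big.
rewrite exchange_big /=; apply: eq_bigr => t _.
rewrite {1}/pressure_grad dotC dot_sumr mulr_sumr; apply: eq_bigr => i _.
rewrite dotZr dotC /pressure_grad dot_sumr !mulr_sumr; apply: eq_bigr => j _.
by rewrite dotZr [dot (cell_grad i t) _]dotC; ring.
Qed.

Lemma G_b_mul z k : (G_b Omega phi *m z) k 0 =
  bubble_mass (enum_val k).1 * pressure_grad z (enum_val k).1 0 (enum_val k).2.
Proof.
rewrite mxE /pressure_grad summxE mulr_sumr; apply: eq_bigr => i _.
rewrite [X in _ = _ * X]mxE mulrCA mulrC; congr (_ * _); rewrite mxE.
move: (enum_val k) => [s j] /=.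
rewrite (tiles (F := fun t x => (s == t)%:R * cell_grad i t 0 j * bpoly t x)).
- rewrite (bigD1 s)//= [X in _ + X]big1 => [|t ts].
    rewrite addr0 integral_RnZ; [|exact/icell_region|exact: bounded_on_bpoly].
    by rewrite eqxx mul1r mulrC.
  rewrite integral_RnZ; [|exact/icell_region|exact: bounded_on_bpoly].
  by rewrite eq_sym (negbTE ts) !mul0r.
- by move=> t; apply: bounded_onZ; exact: bounded_on_bpoly.
move=> t x tx; rewrite (grad_phi _ tx) /vbubble /= dotC dotZr dot_delta.
by rewrite (bubble_icell triM _ tx); ring.
Qed.

End affine_pressures.

(** On a cell with coefficient vector [v] and scalar bubble of gradient [q], the
    elastic energy is [mu |v|^2 |q|^2 + (mu + lambda) (v . q)^2], integrated. By
    the Cauchy-Schwarz inequality it lies between [k0] and [k1] times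
    [|v|^2 |q|^2], whatever the sign of [mu + lambda]. *)
Lemma schur_complement_bounds (R : realType) (d : nat) (d_gt0 : (0 < d)%N)
    (Omega : set 'rV[R]_d) (regular_Omega : (closure Omega)° = Omega)
    (lambda mu k0 k1 K : R) (k0_gt0 : 0 < k0)
    (k0mu : k0 <= mu <= k1) (k0la : k0 <= 2 * mu + lambda <= k1) (K_gt0 : 0 < K)
    (M : mesh R d) (phi : 'I_(nV M) -> 'rV[R]_d -> R) :
  triangulation M Omega ->
  (forall (t : 'I_(nT M)) k, enorm (dbary t k) * mesh_size M <= K) ->
  nodal_basis Omega phi ->
  forall z : 'cV[R]_(nV M),
    k1^-1 * ratio_lower d K * mesh_size M ^+ 2 * qform (stiffness Omega phi) z
      <= qform (S_b Omega lambda mu phi) z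
      <= k0^-1 * ratio_upper d K * mesh_size M ^+ 2 * qform (stiffness Omega phi) z.
Proof.
move=> triM gradK nodal z.
have unitM t := unit_bary_mx triM t.
have aff i (t : 'I_(nT M)) : affine_on (simplex t) (phi i) by case: (nodal i) => -[].
have [k0m mk1] := andP k0mu; have [k0l lk1] := andP k0la.
have k1_gt0 : 0 < k1 by apply: lt_le_trans mk1; exact: lt_le_trans k0m.
have en_gt0 t : 0 < bubble_energy t := bubble_energy_gt0 d_gt0 unitM K_gt0 gradK t.
pose w (k : 'I_#|{: bubble_index M}|) := bubble_energy (enum_val k).1.
pose A := A_b Omega M lambda mu.
have Asym : A^T = A.
  apply/matrixP => k l.
  rewrite mxE !(A_bE d_gt0 regular_Omega triM) [(enum_val l).1 == _]eq_sym.
  case: eqVneq => [->|_]; last by rewrite !mul0r.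
  rewrite !elastic_blockE [(enum_val l).2 == _]eq_sym !mul1r !mxE.
  by congr (_ + _ * _); apply: eq_integral_Rn => x _; rewrite mulrC.
have wE (y : 'cV[R]_#|{: bubble_index M}|) :
    \sum_k w k * y k 0 ^+ 2 =
    \sum_t bubble_energy t * dot (cell_part y t) (cell_part y t).
  rewrite (sum_cell_part y (fun b c => bubble_energy b.1 * c ^+ 2)).
  by apply: eq_bigr => t _; rewrite mulr_sumr; apply: eq_bigr => j _; rewrite expr2.
have Abnd (y : 'cV_#|{: bubble_index M}|) : k0 * \sum_k w k * y k 0 ^+ 2 <= qform A y
    <= k1 * \sum_k w k * y k 0 ^+ 2.
  rewrite wE (A_b_qform d_gt0 regular_Omega triM) !mulr_sumr.
  suff H t : k0 * (bubble_energy t * dot (cell_part y t) (cell_part y t)) <=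
      mu * (bubble_energy t * dot (cell_part y t) (cell_part y t)) + (mu + lambda) *
        integral_Rn (icell t) (fun x => dot (cell_part y t) (bgrad t x) ^+ 2) <=
      k1 * (bubble_energy t * dot (cell_part y t) (cell_part y t)).
    by apply/andP; split; apply: ler_sum => t _; have /andP[] := H t.
  set v := cell_part y t; set E := _ * dot v v; set X := integral_Rn _ _.
  have X0 : 0 <= X by apply: integral_Rn_ge0 => x _; exact: sqr_ge0.
  have XE : X <= E.
    rewrite /E mulrC /bubble_energy -integral_RnZ; last 2 first.
    - exact: icell_region.
    - exact: bounded_on_bgrad_sqr.
    apply: le_integral_Rn; first exact: icell_region.
    - under eq_fun do rewrite expr2.
      by apply: bounded_onM; apply: bounded_on_sum => j; apply: bounded_onZ;
        exact: bounded_on_bgrad.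
    - by apply: bounded_onZ; exact: bounded_on_bgrad_sqr.
    - by move=> x _; exact: dot_CauchySchwarz.
  (* The middle term is affine in [X], with values [mu * E] and
     [(2 * mu + lambda) * E] at the ends of [0 <= X <= E]. *)
  have -> : mu * E + (mu + lambda) * X = mu * (E - X) + (2 * mu + lambda) * X.
    by ring.
  have EX0 : 0 <= E - X by rewrite subr_ge0.
  have split_E k : k * E = k * (E - X) + k * X by ring.
  by rewrite !split_E; apply/andP; split; apply: lerD; apply: ler_wpM2r.
have w_gt0 k : 0 < w k by exact: en_gt0.
have bE : \sum_k (G_b Omega phi *m z) k 0 ^+ 2 / w k =
    \sum_t bubble_mass t ^+ 2 / bubble_energy t *
      dot (pressure_grad aff z t) (pressure_grad aff z t).
  under eq_bigr => k _ do rewrite (G_b_mul d_gt0 regular_Omega triM aff).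
  rewrite (sum_bubble_index (fun b => (bubble_mass b.1 *
    pressure_grad aff z b.1 0 b.2) ^+ 2 / bubble_energy b.1)).
  apply: eq_bigr => t _; rewrite mulr_sumr; apply: eq_bigr => j _ /=.
  by field; rewrite gt_eqF.
rewrite qform_conjugate.
have /andP[lo up] := invmx_energy_bounds k0_gt0 k1_gt0 w_gt0 Asym Abnd
  (G_b Omega phi *m z).
rewrite (stiffness_qform d_gt0 regular_Omega triM aff).
have := bubble_ratio d_gt0 unitM K_gt0 gradK.
move: (ratio_lower d K) (ratio_upper d K) (mesh_size M ^+ 2) => r0 r1 h2 ratio.
apply/andP; split.
  apply: le_trans lo; rewrite bE -!mulrA ler_pM2l ?invr_gt0// !mulr_sumr.
  apply: ler_sum => t _; rewrite !mulrA; apply: ler_wpM2r; first exact: dot_ge0.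
  by have /andP[] := ratio t.
apply: le_trans up _; rewrite bE -!mulrA ler_pM2l ?invr_gt0// !mulr_sumr.
apply: ler_sum => t _; rewrite !mulrA; apply: ler_wpM2r; first exact: dot_ge0.
by have /andP[] := ratio t.
Qed.

Unset Implicit Arguments.
Theorem theorem3 (R : realType) (d : nat) (d_gt0 : (0 < d)%N)
    (Omega : set 'rV[R]_d) (domain_Omega : domain Omega)
    (lambda mu : R) (mu_gt0 : 0 < mu) (bulk_gt0 : 0 < 2 * mu + d%:R * lambda)
    (sigma tau : R) :
  exists c0 c1 : R, 0 < c0 /\ 0 < c1 /\
    forall (M : mesh R d) (phi : 'I_(nV M) -> 'rV[R]_d -> R),
      triangulation M Omega -> shape_regular M sigma -> quasi_uniform M tau ->
      nodal_basis Omega phi ->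
      forall x : 'cV[R]_(nV M),
        c0 * mesh_size M ^+ 2 * qform (stiffness Omega phi) x
          <= qform (S_b Omega lambda mu phi) x
          <= c1 * mesh_size M ^+ 2 * qform (stiffness Omega phi) x.
Proof.
case: domain_Omega => _ _ _ regular_Omega.
pose k0 := Num.min mu (2 * mu + lambda); pose k1 := Num.max mu (2 * mu + lambda).
(* The summand 1 keeps [K] positive when [sigma * tau] vanishes. *)
pose K := `|sigma * tau| + 1.
have K_gt0 : 0 < K by rewrite ltr_wpDl.
have d1 : 1 <= d%:R :> R by rewrite ler1n.
have la_gt0 : 0 < 2 * mu + lambda.
  have [la0|la0] := leP 0 lambda; first lra.
  by apply: lt_le_trans bulk_gt0 _; rewrite lerD2l -[leRHS]mul1r ler_wnM2r// ltW.
have k0_gt0 : 0 < k0 by rewrite lt_min mu_gt0.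
have k1_gt0 : 0 < k1 by rewrite lt_max mu_gt0.
exists (k1^-1 * ratio_lower d K), (k0^-1 * ratio_upper d K).
split; first by rewrite mulr_gt0 ?invr_gt0// ratio_lower_gt0.
split; first by rewrite mulr_gt0 ?invr_gt0// ratio_upper_gt0.
move=> M phi triM shapeM quasiM nodal z.
apply: schur_complement_bounds => //.
- by rewrite ge_min lexx /= le_max lexx.
- by rewrite ge_min lexx orbT /= le_max lexx orbT.
move=> t k; apply: le_trans (enorm_dbary_mesh_size d_gt0 _ shapeM quasiM t k) _.
  exact: unit_bary_mx triM.
by rewrite lerDl.
Qed.
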